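(* Let $(S^{2n+1},T^{1,0}S^{2n+1},\theta_0)$ be the CR unit sphere. For $0<\gamma<n+1$, let $(w,w')\in\mathbb R^2$ be such that $w+w'+n+1=\gamma$ and $w-w'\in\mathbb Z$, and let $\mathcal A_{w,w'}^{\theta_0}$ be the self-adjoint intertwining operator of order $2\gamma$. Then $$\sum_{l=1}^{n+1}\bar z_l\,\left[\mathcal A_{w,w'}^{\theta_0},z_l\right]=\gamma(\gamma-1-w')\,\mathcal A_{w-1,w'}^{\theta_0},$$ where $z_1,\dots,z_{n+1}$ are the coordinates on $\mathbb C^{n+1}$ restricted to $S^{2n+1}$ (acting by multiplication) and $[\mathcal A,z_l](u)=\mathcal A(z_lu)-z_l\mathcal A(u)$.
   Context: $S^{2n+1}\subset\mathbb C^{n+1}$ is the unit sphere with CR structure $T^{1,0}S^{2n+1}=T^{1,0}\mathbb C^{n+1}\cap\mathbb C TS^{2n+1}$ and contact form $\theta_0=\frac i2\sum_{l=1}^{n+1}(z_l\,d\bar z_l-\bar z_l\,dz_l)|_{S^{2n+1}}$. Functions are complex-valued and the operators act on $C^\infty(S^{2n+1})$. A polynomial $g$ on $\mathbb C^{n+1}$ (in $z,\bar z$) is homogeneous of bidegree $(j,k)$ if $g(\lambda z)=\lambda^j\bar\lambda^k g(z)$ for $\lambda\in\mathbb C$. $\mathcal H^{\mathbb S}_{j,k}$ is the space of restrictions to $S^{2n+1}$ of harmonic homogeneous polynomials of bidegree $(j,k)$; $L^2(S^{2n+1})$ is the orthogonal Hilbert sum of the $\mathcal H^{\mathbb S}_{j,k}$,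 $j,k\ge0$. For $(w,w')$ with $w+w'+n+1=\gamma$ and $w-w'\in\mathbb Z$, an operator $\mathcal A$ is intertwining of order $2\gamma$ if $J_\tau^{\gamma-w}\bar J_\tau^{\gamma-w'}(\mathcal AF)\circ\tau=\mathcal A\left(J_\tau^{-w}\bar J_\tau^{-w'}(F\circ\tau)\right)$ for every $F\in C^\infty(S^{2n+1})$ and every CR automorphism $\tau$ of $S^{2n+1}$, where $J_\tau$ is defined by $\tau^*(dz_1\wedge\cdots\wedge dz_{n+1})=J_\tau^{n+2}\,dz_1\wedge\cdots\wedge dz_{n+1}$, so that $\tau^*\theta_0=|J_\tau|^2\theta_0$. Self-adjoint intertwining operators are diagonal with respect to the $\mathcal H^{\mathbb S}_{j,k}$ and are determined up to a multiplicative constant; with the constant chosen to be $1$, $\mathcal A_{w,w'}^{\theta_0}$ is the operator acting on each $\mathcal H^{\mathbb S}_{j,k}$ as multiplication by $$\frac{\Gamma(j+\gamma-w)}{\Gamma(j-w)}\cdot\frac{\Gamma(k+\gamma-w')}{\Gamma(k-w')} .$$ The operator $\mathcal A_{w-1,w'}^{\theta_0}$, of order $2(\gamma-1)$, is given by the same formula with $(w,w',\gamma)$ replaced by $(w-1,w',\gamma-1)$, i.e. it acts on $\mathcal H^{\mathbb S}_{j,k}$ as multiplication by $\frac{\Gamma(j+\gamma-w)}{\Gamma(j+1-w)}\cdot\frac{\Gamma(k+\gamma-1-w')}{\Gamma(k-w')}$. *)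

(* Defs.v *)
From HB Require Import structures.
From mathcomp Require Import all_boot all_order all_algebra.
From mathcomp Require mpoly.
From mathcomp Require Import complex.
From mathcomp Require Import all_classical all_reals all_analysis.

Set Implicit Arguments.
Unset Strict Implicit.
Unset Printing Implicit Defensive.

Import Order.TTheory GRing.Theory Num.Theory.
Import numFieldNormedType.Exports.

Local Open Scope classical_set_scope.
Local Open Scope ring_scope.
Local Open Scope complex_scope.

Section Gamma.
Context {R : realType}.
Implicit Types x y : R.

Definition Euler_integral x : R :=
  \int[lebesgue_measure]_(t in [set t : R | 0 < t]) (t `^ (x - 1) * expR (- t)).

(* For x <= 0 this iterates Gamma x = Gamma (x + 1) / x until the argument is
   positive. At the poles x = 0, -1, -2, ... the product vanishes and the
   convention _ / 0 = 0 gives the value 0; hence also 1 / Gamma = 0 there. *)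
Definition Gamma x : R :=
  if 0 < x then Euler_integral x
  else let m := (Num.truncn (- x)).+1 in
    Euler_integral (x + m%:R) / \prod_(i < m) (x + i%:R).

Definition Gamma_pole x : Prop := exists m : nat, x = - m%:R.

(* The quotient Gamma y / Gamma x. When x and y are both poles it has a removable
   singularity under simultaneous translation of its arguments, and its value is
   the limit: for y = x + m with m a natural number, the product
   x (x + 1) ... (x + m - 1). *)
Definition Gamma_ratio y x : R :=
  if `[< Gamma_pole y /\ Gamma_pole x >]
  then lim (Gamma (y + t) / Gamma (x + t) @[t --> (0 : R)^'])
  else Gamma y / Gamma x.

End Gamma.

Section Sphere.
Context {R : realType}.
Variable n : nat.
Local Notation C := R[i].

Definition on_sphere (z : 'rV[C]_n.+1) : bool :=
  \sum_(l < n.+1) `|z 0 l| ^+ 2 == 1.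

(* The unit sphere of C^(n+1), of real dimension 2n+1. *)
Definition sphere : Type := {z : 'rV[C]_n.+1 | on_sphere z}.

Definition sphere_coord (l : 'I_n.+1) (z : sphere) : C := \val z 0 l.

Lemma on_sphere_delta0 : on_sphere (delta_mx 0 0).
Proof.
rewrite /on_sphere (bigD1 ord0) //= big1 => [|l l0].
  by rewrite mxE !eqxx normr1 expr1n addr0.
by rewrite mxE (negPf l0) andbF normr0 expr0n.
Qed.

HB.instance Definition _ := Choice.on sphere.
HB.instance Definition _ := isPointed.Build sphere
  (exist _ (delta_mx 0 0) on_sphere_delta0 : sphere).

Definition real_coords (z : 'rV[C]_n.+1) : 'rV[R]_(n.+1 + n.+1) :=
  row_mx (map_mx (@complex.Re R) z) (map_mx (@complex.Im R) z).

Definition sphere_open : set (set sphere) :=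
  [set (fun z : sphere => real_coords (\val z)) @^-1` U |
     U in [set U : set 'rV[R]_(n.+1 + n.+1) | open U]].

Definition borel_sphere := g_sigma_algebraType sphere_open.

(* The normalized surface measure is the only U(n+1)-invariant Borel probability
   on the sphere. As theta_0 is U(n+1)-invariant, the volume form
   theta_0 /\ (d theta_0)^n is a constant multiple of it. *)
Definition unitary_invariant (sigma : probability borel_sphere R) : Prop :=
  forall (U : 'M[C]_n.+1) (phi : sphere -> sphere), U \is unitarymx ->
    (forall z, \val (phi z) = \val z *m U) ->
  forall E : set borel_sphere, measurable E -> sigma (phi @^-1` E) = sigma E.

Definition cintegral (sigma : probability borel_sphere R)
    (f : sphere -> C) : C :=
  (\int[sigma]_z complex.Re (f z)) +i* (\int[sigma]_z complex.Im (f z)).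

Definition inner (sigma : probability borel_sphere R) (u v : sphere -> C) : C :=
  cintegral sigma (fun z => u z * (v z)^*).

Fixpoint Ck m (k : nat) (F : 'rV[R]_m -> R) : Prop :=
  if k is k'.+1 then
    [/\ continuous F,
        forall (i : 'I_m) x, derivable F x (delta_mx 0 i) &
        forall i : 'I_m, Ck k' (fun x => 'D_(delta_mx 0 i) F x)]
  else continuous F.

Definition smooth m (F : 'rV[R]_m -> R) : Prop := forall k, Ck k F.

(* The sphere is a closed submanifold of R^(2n+2), so its smooth functions are
   the restrictions of the smooth functions on R^(2n+2). *)
Definition sphere_smooth (u : sphere -> C) : Prop :=
  exists F G : 'rV[R]_(n.+1 + n.+1) -> R, [/\ smooth F, smooth G &
    forall z : sphere,
      u z = F (real_coords (\val z)) +i* G (real_coords (\val z))].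

(* Polynomials in (z, zbar): the variables are z_1, ..., z_(n+1) followed by
   their conjugates, treated as independent. *)
Definition zpoly := mpoly.mpoly (n.+1 + n.+1) C.

Definition zeval (p : zpoly) (z : 'rV[C]_n.+1) : C :=
  mpoly.meval (fun i => row_mx z (map_mx Num.conj z) 0 i) p.

Definition bihomogeneous (j k : nat) (p : zpoly) : Prop :=
  forall (a : C) (z : 'rV[C]_n.+1),
    zeval p (a *: z) = a ^+ j * a^* ^+ k * zeval p z.

(* The Laplacian of C^(n+1) is 4 times the sum of the d^2 / dz_l dzbar_l. *)
Definition harmonic (p : zpoly) : Prop :=
  4%:R *: (\sum_(l < n.+1) mpoly.mderiv (lshift n.+1 l)
             (mpoly.mderiv (rshift n.+1 l) p)) = 0.

Definition harmonic_space (j k : nat) : set (sphere -> C) :=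
  [set u | exists p : zpoly, [/\ bihomogeneous j k p, harmonic p &
     forall z : sphere, u z = zeval p (\val z)]].

Definition intertwining_eigenvalue (gamma w w' : R) (j k : nat) : R :=
  Gamma_ratio (j%:R + gamma - w) (j%:R - w) *
  Gamma_ratio (k%:R + gamma - w') (k%:R - w').

(* A is the operator A_(w,w') of order 2 gamma, normalized to have constant 1.
   Self-adjointness and the eigenvalues determine A on all smooth functions,
   since the sum of the harmonic spaces is dense in L^2. The values of A outside
   the smooth functions are irrelevant. *)
Definition normalized_intertwining (sigma : probability borel_sphere R)
    (gamma w w' : R) (A : (sphere -> C) -> (sphere -> C)) : Prop :=
  [/\ forall u, sphere_smooth u -> sphere_smooth (A u),
      forall (a : C) u v, sphere_smooth u -> sphere_smooth v ->
        A (fun z => a * u z + v z) = (fun z => a * A u z + A v z),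
      forall u v, sphere_smooth u -> sphere_smooth v ->
        inner sigma (A u) v = inner sigma u (A v) &
      forall j k u, harmonic_space j k u ->
        A u = (fun z => (intertwining_eigenvalue gamma w w' j k)%:C * u z)].

Definition coord_commutator (A : (sphere -> C) -> (sphere -> C))
    (l : 'I_n.+1) (u : sphere -> C) (z : sphere) : C :=
  A (fun y => sphere_coord l y * u y) z - sphere_coord l z * A u z.

End Sphere.

(* Main.v *)
Require Import Defs.
From mathcomp Require Import all_boot all_order all_algebra.
From mathcomp Require mpoly.
From mathcomp Require Import complex spectral sesquilinear.
From mathcomp Require Import all_classical all_reals all_analysis measurable_realfun.
From mathcomp Require Import ring lra.

(** Write T for the difference of the two sides, seen as an operator on smooth
    functions: T u = sum_l conj(z_l) [A, z_l] u - gamma (gamma - 1 - w') B u.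
    The proof shows that T kills the spherical harmonics by algebra, and then
    that, being symmetric and smoothness-preserving, it kills every smooth function.

    Algebra.  If Y is a harmonic polynomial of bidegree (j, k), then
    z_l Y = (z_l Y - c |z|^2 dY/dzbar_l) + c |z|^2 dY/dzbar_l with
    c = 1 / (n + j + k), and the two terms restrict to harmonics of bidegrees
    (j+1, k) and (j, k-1) ([mul_coord_decomposition]).  Hence A acts on z_l Y
    through the eigenvalues lambda(j+1, k) and lambda(j, k-1).  Contracting with
    conj(z_l) and using |z|^2 = 1 and the Euler identity
    sum_l zbar_l dY/dzbar_l = k Y leaves the scalar
    lambda(j+1,k) + c k (lambda(j,k-1) - lambda(j+1,k)) - lambda(j,k).  The
    functional equation of Gamma writes the three eigenvalues as polynomial
    multiples of the eigenvalue of B, at the poles as well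
    ([intertwining_eigenvalueE]), and the scalar becomes gamma (gamma - 1 - w') times it
    ([eigenvalue_balance], [defect_harmonic]).

    Passage to smooth functions.  Since A and B are symmetric, so is T, because the
    adjoint of conj(z_l) A z_l is itself ([defect_selfadjoint]).  So T u is
    orthogonal to every finite sum of harmonics.  The decomposition above and its
    conjugate show that these sums are stable under multiplication by z_l and
    conj(z_l); they therefore contain every power of the peak function
    (1 + Re <z, a>) / 2, which has its maximum 1 only at a
    ([harmonic_sum_peak]).  A continuous function orthogonal to all these powers
    vanishes at a: they concentrate on small caps around a, and caps have positive
    measure ([peak_separation]).  The last point holds because the unitary group
    is transitive on the sphere, so that a null cap would have null translates,
    finitely many of which cover the compact sphere ([cap_pos]). *)

Set Implicit Arguments.
Unset Strict Implicit.
Unset Printing Implicit Defensive.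

Import Order.TTheory GRing.Theory Num.Theory.
Import numFieldNormedType.Exports.

Local Open Scope classical_set_scope.
Local Open Scope ring_scope.
Local Open Scope complex_scope.

(** * The Gamma function and the eigenvalues *)

Section GammaFunction.
Context {R : realType}.
Implicit Types x y t : R.
Local Notation mu := lebesgue_measure.

Definition euler_fun x t : R := t `^ (x - 1) * expR (- t).

Lemma euler_fun_ge0 x t : 0 <= euler_fun x t.
Proof. by rewrite mulr_ge0 ?powR_ge0 ?expR_ge0. Qed.

(** Extended-real-valued, so that the functional equation can be proved before
    the integral is known to be finite; finiteness is then deduced from it. *)
Definition euler_int x : \bar R :=
  (\int[mu]_(t in [set t : R | (0 < t)%R]) (euler_fun x t)%:E)%E.

Lemma Euler_integralE x : Euler_integral x = fine (euler_int x).
Proof. by []. Qed.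

(** Compact intervals filling the half-line, on which integration by parts has no
    improper endpoint. *)
Definition exhaust (n : nat) : set R := `[n.+1%:R^-1, n.+1%:R]%classic.

Lemma bigcup_exhaust : \bigcup_n exhaust n = [set t : R | 0 < t].
Proof.
apply/seteqP; split=> t /=.
  by move=> [n _]; rewrite /exhaust/= in_itv/= => /andP[+ _]; apply: lt_le_trans; rewrite invr_gt0.
move=> t0; exists (Num.truncn (Num.max t t^-1)) => //=.
rewrite /exhaust/= in_itv/=; have h : Num.max t t^-1 < (Num.truncn (Num.max t t^-1)).+1%:R.
  exact: truncnS_gt.
move: h; rewrite gt_max => /andP[h1 h2]; rewrite (ltW h1) andbT.
by rewrite -[leRHS]invrK lef_pV2 ?posrE ?invr_gt0// ltW.
Qed.

Lemma exhaust_nondecreasing : nondecreasing_seq exhaust.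
Proof.
move=> m n mn; rewrite subsetEset => t; rewrite /exhaust /= !in_itv/= => /andP[a b].
rewrite (le_trans _ a) ?(le_trans b) ?ler_nat ?ltnS//.
by rewrite lef_pV2 ?posrE// ler_nat ltnS.
Qed.

Lemma continuous_powRr x t : 0 < t -> {for t, continuous (fun t : R => t `^ x)}.
Proof.
move=> t0; apply: differentiable_continuous; apply/derivable1_diffP.
by apply: derivable_powR; rewrite in_itv/= t0.
Qed.

Lemma continuous_euler_fun x t : 0 < t -> {for t, continuous (euler_fun x)}.
Proof.
move=> t0; apply: continuousM; last first.
  apply: continuous_comp; first exact: opp_continuous.
  exact: continuous_expR.
exact: continuous_powRr.
Qed.

Lemma measurable_euler_fun x (D : set R) : D `<=` [set t | 0 < t] -> measurable D ->
  measurable_fun D (EFin \o euler_fun x).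
Proof.
move=> D0 mD; apply/measurable_EFinP; apply: (@measurable_funS _ _ _ _
  (`]0, +oo[%classic : set (measurableTypeR R))) => //.
  by move=> t /D0 /=; rewrite in_itv/= andbT.
apply: open_continuous_measurable_fun => //.
by move=> t; rewrite inE/= in_itv/= andbT; exact: continuous_euler_fun.
Qed.

Lemma cvg_euler_int x :
  (\int[mu]_(t in exhaust n) (euler_fun x t)%:E)%E @[n --> \oo] --> euler_int x.
Proof.
rewrite /euler_int -bigcup_exhaust.
apply: ge0_nondecreasing_set_cvg_integral.
- exact: exhaust_nondecreasing.
- by move=> i; exact: measurable_itv.
- move=> i; apply: measurable_euler_fun; last exact: measurable_itv.
  by rewrite -bigcup_exhaust; exact: bigcup_sup.
- by move=> *; rewrite lee_fin euler_fun_ge0.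
Qed.

(** Compare [t `^ (x - 1)] with a power [t ^ m], and [expR t] with the term of
    degree m + 1 of its series. *)
Lemma euler_fun_cvg_infty x :
  euler_fun x n.+1%:R @[n --> \oo] --> (0 : R).
Proof.
pose m := (Num.truncn `|x - 1|).+1.
apply: (@squeeze_cvgr _ _ _ _ (fun=> 0) (fun n => (m.+1)`!%:R * n.+1%:R^-1)).
- near=> n; rewrite euler_fun_ge0/=.
  rewrite /euler_fun expRN.
  have n1 : (1 : R) <= n.+1%:R by rewrite ler1n.
  have h1 : n.+1%:R `^ (x - 1) <= n.+1%:R ^+ m :> R.
    rewrite -powR_mulrn// ler_powR//.
    by rewrite (le_trans (ler_norm _))// ltW// truncnS_gt.
  have h2 : n.+1%:R ^+ m.+1 / (m.+1)`!%:R <= expR n.+1%:R :> R.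
    by apply: (le_trans _ (@expR_ge1Dxn R n.+1%:R m _)) => //; rewrite lerDr.
  rewrite ler_pdivrMr ?expR_gt0//.
  apply: (le_trans h1).
  have := ler_wpM2l (_ : 0 <= (m.+1)`!%:R * n.+1%:R^-1 :> R) h2.
  rewrite mulr_ge0// => /(_ isT); apply: le_trans.
  have f0 : (m.+1)`!%:R != 0 :> R by rewrite pnatr_eq0 -lt0n fact_gt0.
  rewrite exprS le_eqVlt; apply/orP; left; apply/eqP.
  by rewrite -!mulrA mulKf ?pnatr_eq0// mulrCA divff// mulr1.
- exact: cvg_cst.
- rewrite -[0](mulr0 (m.+1)`!%:R); apply: cvgM; first exact: cvg_cst.
  exact: cvg_harmonic.
Unshelve. all: by end_near. Qed.

Lemma euler_fun_cvg0 x : 0 < x ->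
  euler_fun (x + 1) n.+1%:R^-1 @[n --> \oo] --> (0 : R).
Proof.
move=> x0; apply: (@squeeze_cvgr _ _ _ _ (fun=> 0) (fun n => n.+1%:R^-1 `^ x)).
- near=> n; rewrite euler_fun_ge0/= /euler_fun addrK.
  by rewrite ler_piMr ?powR_ge0// -expR0 ler_expR lerNl oppr0.
- exact: cvg_cst.
- apply: (@cvg_comp _ _ _ (fun n => n.+1%:R^-1 : R) (fun a => a `^ x) _ 0^'+);
    last exact: powR_cvg0.
  move=> A /= [e /= e0 eA].
  near=> n; apply: eA => //=; rewrite sub0r normrN ger0_norm//.
  near: n; exact: near_infty_natSinv_lt (PosNum e0).
Unshelve. all: by end_near. Qed.

Lemma is_derive_expRN t : is_derive t 1 (fun t : R => - expR (- t)) (expR (- t)).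
Proof. by apply: is_derive_eq => /=; rewrite mulrN1 opprK. Qed.

(** Integration by parts of [t `^ x] against [expR (- t)]. *)
Lemma euler_int_exhaustS x n : 0 < x ->
  (\int[mu]_(t in exhaust n.+1) (euler_fun (x + 1) t)%:E =
   (euler_fun (x + 1) n.+2%:R^-1 - euler_fun (x + 1) n.+2%:R)%:E +
   x%:E * \int[mu]_(t in exhaust n.+1) (euler_fun x t)%:E)%E.
Proof.
move=> x0; have ab : n.+2%:R^-1 < n.+2%:R :> R.
  by rewrite (@lt_le_trans _ _ 1) ?invf_lt1 ?ler1n ?ltr1n.
have pos t : t \in `[n.+2%:R^-1, n.+2%:R] -> 0 < t :> R.
  by rewrite in_itv/= => /andP[+ _]; apply: lt_le_trans; rewrite invr_gt0.
have dF t : 0 < t -> derivable (fun t : R => t `^ x) t 1.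
  by move=> t0; apply: derivable_powR; rewrite in_itv/= t0.
have cF t : 0 < t -> {for t, continuous (fun t : R => t `^ x)}.
  by move=> t0; apply: differentiable_continuous; apply/derivable1_diffP/dF.
have dG t : derivable (fun t : R => - expR (- t)) t 1.
  by apply: ex_derive; exact: is_derive_expRN.
have cG t : {for t, continuous (fun t : R => - expR (- t))}.
  by apply: differentiable_continuous; apply/derivable1_diffP/dG.
have := @integration_by_parts R (fun t => t `^ x) (fun t => - expR (- t))
  (fun t => x * t `^ (x - 1)) (fun t => expR (- t)) n.+2%:R^-1 n.+2%:R ab.
have -> : (\int[mu]_(t in exhaust n.+1) (euler_fun (x + 1) t)%:E =
  \int[mu]_(t in `[n.+2%:R^-1%R, n.+2%:R%R]) (t `^ x * expR (- t))%:E)%E.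
  by apply: eq_integral => t _; rewrite /euler_fun addrK.
move=> ->.
- rewrite /euler_fun !addrK !mulrN opprK [(- _ + _)%R]addrC; congr (_ + _)%E.
  rewrite -/(euler_fun _) -ge0_integralZl_EFin//=; last 4 first.
  + exact: measurable_itv.
  + by move=> t _; rewrite lee_fin euler_fun_ge0.
  + apply: measurable_euler_fun; last exact: measurable_itv.
    by rewrite -bigcup_exhaust; exact: bigcup_sup.
  + exact: ltW.
  rewrite -[RHS]oppeK -[X in _ = (- X)%E]integral_ge0N/=; last first.
    by move=> t _; rewrite mule_ge0// lee_fin ?euler_fun_ge0 ?ltW.
  congr (- _)%E; apply: eq_integral => t _; rewrite -?EFinM -?EFinN.
  by congr (_%:E); rewrite mulrN mulrA.
- apply: continuous_in_subspaceT => t; rewrite inE/= => /pos t0.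
  by apply: cvgM; [exact: cvg_cst|exact: (@continuous_powRr (x - 1) t t0)].
- split.
  + by move=> t /(subset_itvW _ _ (lexx _) (lexx _)) /pos; exact: dF.
  + by apply: cvg_at_right_filter; apply: cF; rewrite invr_gt0.
  + by apply: cvg_at_left_filter; apply: cF.
- move=> t /(subset_itvW _ _ (lexx _) (lexx _)) /pos t0.
  by rewrite powR_derive1// in_itv/= t0.
- apply: continuous_in_subspaceT => t _.
  apply: continuous_comp; first exact: opp_continuous.
  exact: continuous_expR.
- split.
  + by move=> t _; exact: dG.
  + by apply: cvg_at_right_filter; exact: cG.
  + by apply: cvg_at_left_filter; exact: cG.
- move=> t _; rewrite derive1E; apply: derive_val.
  exact: is_derive_expRN.
Qed.

Lemma euler_intS x : 0 < x -> euler_int (x + 1) = (x%:E * euler_int x)%E.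
Proof.
move=> x0.
have h n := @euler_int_exhaustS x n x0.
have c1 : (\int[mu]_(t in exhaust n.+1) (euler_fun (x + 1) t)%:E)%E @[n --> \oo]
    --> euler_int (x + 1).
  by have := @cvg_euler_int (x + 1); rewrite -cvg_shiftS.
have c2 : (\int[mu]_(t in exhaust n.+1) (euler_fun x t)%:E)%E @[n --> \oo]
    --> euler_int x.
  by have := @cvg_euler_int x; rewrite -cvg_shiftS.
have c3 : (euler_fun (x + 1) n.+2%:R^-1 - euler_fun (x + 1) n.+2%:R) @[n --> \oo] --> (0 : R).
  rewrite -[0]subr0; apply: cvgB.
    by have := @euler_fun_cvg0 x x0; rewrite -cvg_shiftS.
  by have := @euler_fun_cvg_infty (x + 1); rewrite -cvg_shiftS.
move: c1; under eq_cvg do rewrite h.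
move=> c1; apply/esym/(cvg_unique _ _ c1) => //.
rewrite -[(_ * euler_int x)%E]add0e; apply: cvgeD => //.
- by apply: cvg_EFin => //; exact: nearW.
- by apply: cvgeZl.
Qed.

Lemma euler_int_ge0 x : (0 <= euler_int x)%E.
Proof. by apply: integral_ge0 => t _; rewrite lee_fin euler_fun_ge0. Qed.

Lemma measurable_pos_set : measurable ([set t | 0 < t] : set (measurableTypeR R)).
Proof.
rewrite (_ : mkset _ = `]0, +oo[%classic); first exact: measurable_itv.
by apply/seteqP; split=> t /=; rewrite in_itv/= andbT.
Qed.

Lemma euler_int1 : euler_int 1 = 1%E.
Proof.
rewrite -(@integral_exponential_pdf R 1)//.
rewrite /exponential_pdf (_ : (fun x => _) =
    (EFin \o (fun x => 1 * expR (- 1 * x))) \_ `[0%R, +oo[%classic); last first.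
  by apply/funext => x /=; rewrite restrict_EFin.
rewrite -integral_mkcond -integral_itv_obnd_cbnd; last first.
  apply/measurable_EFinP; apply: (@measurable_funS _ _ _ _ setT) => //.
  apply: continuous_measurable_fun => t.
  apply: cvgM; first exact: cvg_cst.
  apply: continuous_comp; last exact: continuous_expR.
  by apply: cvgM; [exact: cvg_cst|exact: cvg_id].
rewrite /euler_int (_ : mkset _ = `]0, +oo[%classic); last first.
  by apply/seteqP; split=> t /=; rewrite in_itv/= andbT.
apply: eq_integral => t _.
by rewrite /euler_fun/= subrr powRr0 !mul1r mulN1r.
Qed.

Lemma euler_int_nat (m : nat) : euler_int m.+1%:R \is a fin_num.
Proof.
elim: m => [|m IH]; first by rewrite euler_int1.
by rewrite -natr1 euler_intS// fin_numM.
Qed.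

(** For x at least 1, [t `^ (x - 1)] is at most 1 + t ^ m, and the integral at
    positive integers is finite by induction; for x < 1 the functional equation
    bounds the integral at x by the one at x + 1. *)
Lemma euler_int_fin x : 0 < x -> euler_int x \is a fin_num.
Proof.
have main y : 1 <= y -> euler_int y \is a fin_num.
  move=> y1; pose m := Num.truncn y.
  rewrite ge0_fin_numE ?euler_int_ge0//.
  apply: (@le_lt_trans _ _ (euler_int 1 + euler_int m.+1%:R)%E); last first.
    by rewrite euler_int1 lte_add_pinfty ?ltry// ltey_eq euler_int_nat.
  rewrite /euler_int -ge0_integralD//=; first last.
  - by apply: measurable_euler_fun => //; exact: measurable_pos_set.
  - by move=> t _; rewrite lee_fin euler_fun_ge0.
  - by apply: measurable_euler_fun => //; exact: measurable_pos_set.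
  - by move=> t _; rewrite lee_fin euler_fun_ge0.
  - exact: measurable_pos_set.
  apply: ge0_le_integral => //=.
  - exact: measurable_pos_set.
  - by move=> t _; rewrite lee_fin euler_fun_ge0.
  - by apply: measurable_euler_fun => //; exact: measurable_pos_set.
  - by apply: emeasurable_funD; apply: measurable_euler_fun => //; exact: measurable_pos_set.
  - move=> t t0; rewrite lee_fin /euler_fun -mulrDl ler_wpM2r ?expR_ge0//.
    rewrite subrr powRr0 -natr1 addrK.
    have [t1|t1] := leP t 1.
      rewrite (@le_trans _ _ 1) ?lerDl ?powR_ge0//.
      apply: (@le_trans _ _ (1 `^ (y - 1))); last by rewrite powR1.
      by rewrite ge0_ler_powR// ?nnegrE ?subr_ge0// ltW.
    rewrite (@le_trans _ _ (t `^ m%:R)) ?lerDr//.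
    apply: ler_powR; first exact: ltW.
    by rewrite lerBlDr natr1 ltW// truncnS_gt.
move=> x0; have [x1|x1] := leP 1 x; first exact: main.
have /main : 1 <= x + 1 by rewrite lerDr ltW.
rewrite euler_intS//; case: (euler_int x) (euler_int_ge0 x) => //.
by rewrite gt0_muley.
Qed.

(** It is enough to bound the integrand below on [1, 2]. *)
Lemma euler_int_gt0 x : (0 < euler_int x)%E.
Proof.
pose a := `|x - 1|; pose c := (2 `^ a)^-1 * expR (- 2).
have c0 : 0 < c by rewrite mulr_gt0 ?expR_gt0 ?invr_gt0 ?powR_gt0.
have sub : `[1, 2] `<=` [set t : R | 0 < t].
  by move=> t /=; rewrite in_itv/= => /andP[+ _]; exact: lt_le_trans.
apply: (@lt_le_trans _ _ (\int[mu]_(t in `[1%R, 2%R]) c%:E)%E).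
  rewrite integral_cst//= lebesgue_measure_itv/= lte_fin ltr1n/=.
  by rewrite -EFinB -EFinM lte_fin mulr_gt0// subr_gt0 ltr1n.
apply: (@le_trans _ _ (\int[mu]_(t in `[1%R, 2%R]) (euler_fun x t)%:E)%E).
  apply: ge0_le_integral => //=.
  - by move=> t _; rewrite lee_fin ltW.
  - exact: measurable_euler_fun.
  - move=> t; rewrite in_itv/= => /andP[t1 t2]; rewrite lee_fin.
    apply: ler_pM; rewrite ?invr_ge0 ?powR_ge0 ?expR_ge0//; last first.
      by rewrite ler_expR lerN2.
    apply: (@le_trans _ _ (t `^ (- a))).
      rewrite powRN lef_pV2 ?posrE ?powR_gt0// ?(lt_le_trans _ t1)//.
      by rewrite ge0_ler_powR// ?nnegrE ?normr_ge0// (le_trans _ t1).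
    by rewrite ler_powR// lerNl ler_normr lexx orbT.
apply: ge0_subset_integral => //.
- exact: measurable_pos_set.
- by apply: measurable_euler_fun => //; exact: measurable_pos_set.
- by move=> t _; rewrite lee_fin euler_fun_ge0.
Qed.

Lemma Gamma_gt0 x : 0 < x -> 0 < Gamma x.
Proof.
move=> x0; rewrite /Gamma x0 Euler_integralE fine_gt0// euler_int_gt0/=.
by rewrite ltey_eq euler_int_fin.
Qed.

Lemma Euler_integralS x : 0 < x -> Euler_integral (x + 1) = x * Euler_integral x.
Proof. by move=> x0; rewrite !Euler_integralE euler_intS// fineM// euler_int_fin. Qed.

(** The value at x = 0 is excluded because there the left side is 1 while the
    convention at poles makes the right side 0. *)
Lemma GammaS x : x != 0 -> Gamma (x + 1) = x * Gamma x.
Proof.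
move=> xn0; rewrite /Gamma; case: ltP => x1; case: ltP => x0.
- exact: Euler_integralS.
- have -> : Num.truncn (- x) = 0%N.
    by apply: truncn_def; lra.
  by rewrite big_ord1 addr0 mulrC divfK.
- by exfalso; lra.
- have -> : Num.truncn (- x) = (Num.truncn (- (x + 1))).+1.
    apply: truncn_def; have : 0 <= - (x + 1) by lra.
    move=> /truncn_itv; rewrite -!natr1; lra.
  rewrite [in RHS]big_ord_recl addr0.
  under [in RHS]eq_bigr do rewrite lift0 -natr1 [_%:R + 1]addrC addrA.
  by rewrite -[in RHS]natr1 [_%:R + 1]addrC addrA invfM mulrCA mulVKf.
Qed.

Lemma Gamma_neq0 x : ~ Gamma_pole x -> Gamma x != 0.
Proof.
rewrite /Gamma => xp; case: ltP => x0.
  by have := Gamma_gt0 x0; rewrite /Gamma x0 => /lt0r_neq0.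
set m := (Num.truncn _).+1.
have h : 0 < x + m%:R by rewrite -ltrBlDl sub0r; exact: truncnS_gt.
have := Gamma_gt0 h; rewrite /Gamma h => h'.
apply: mulf_neq0; first exact: lt0r_neq0.
apply: invr_neq0; apply/prodf_neq0 => i _.
by apply/eqP => xi; apply: xp; exists i; apply/eqP; rewrite -addr_eq0 xi.
Qed.

Lemma Gamma_pole0 x : Gamma_pole x -> Gamma x = 0.
Proof.
move=> [m xm]; rewrite /Gamma ltNge {1}xm oppr_le0 ler0n/=.
have lm : (m < (Num.truncn (- x)).+1)%N by rewrite xm opprK natrK.
by rewrite (bigD1 (Ordinal lm))//= {3}xm addNr mul0r invr0 mulr0.
Qed.

(** The Pochhammer symbol x (x + 1) ... (x + m - 1). *)
Definition rising x (m : nat) : R := \prod_(i < m) (x + i%:R).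

Lemma risingSr x m : rising x m.+1 = rising x m * (x + m%:R).
Proof. by rewrite /rising big_ord_recr. Qed.

Lemma risingSl x m : rising x m.+1 = x * rising (x + 1) m.
Proof.
rewrite /rising big_ord_recl addr0; congr (_ * _); apply: eq_bigr => i _.
by rewrite lift0 -natr1 [_%:R + 1]addrC addrA.
Qed.

Lemma Gamma_rising x m : (forall i, (i < m)%N -> x + i%:R != 0) ->
  Gamma (x + m%:R) = rising x m * Gamma x.
Proof.
elim: m => [|m IH] h; first by rewrite addr0 /rising big_ord0 mul1r.
rewrite -natr1 addrA GammaS ?h// IH; last by move=> i im; rewrite h// ltnW.
by rewrite risingSr mulrA [_ * rising _ _]mulrC.
Qed.

Lemma cvg_rising x m : rising (x + t) m @[t --> (0 : R)^'] --> rising x m.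
Proof.
elim: m => [|m IH].
  by rewrite /rising big_ord0; under eq_fun do rewrite big_ord0; exact: cvg_cst.
rewrite risingSr; under eq_fun do rewrite risingSr.
apply: cvgM => //; apply: cvgD; last exact: cvg_cst.
rewrite -[X in _ --> X]addr0; apply: cvgD; first exact: cvg_cst.
by apply: cvg_within_filter; exact: cvg_id.
Qed.

(** For t small and nonzero x + t is not a pole, so the quotient is the rising
    factorial of x + t there and its limit is the one of x.  When x alone is a
    pole, both sides are 0. *)
Lemma Gamma_ratio_rising x m : Gamma_ratio (x + m%:R) x = rising x m.
Proof.
rewrite /Gamma_ratio; case: asboolP => [[[p yp] [q xq]]|nn].
  apply: cvg_lim => //; apply: (cvg_trans _ (@cvg_rising x m)).
  apply: near_eq_cvg.
  near=> t.
  have t0 : t != 0 by near: t; exact: nbhs_dnbhs_neq.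
  have t1 : `|t| < 1 by near: t; exact: dnbhs0_lt.
  have tZ : t \isn't a Num.int.
    apply/negP => /intrP[i ti]; move: t0 t1; rewrite ti -intr_norm.
    by rewrite intr_eq0 -normr_gt0 (_ : 1 = 1%:~R)// ltr_int; case: `|i| => // -[].
  have hx (i : nat) : x + t + i%:R != 0.
    apply: contra tZ => /eqP xi.
    have -> : t = q%:R - i%:R by move: xi; rewrite xq => h; lra.
    by rewrite rpredB ?rpred_nat.
  have np : Gamma (x + t) != 0.
    by apply: Gamma_neq0 => -[i xi]; move: (hx i); rewrite xi addNr eqxx.
  by rewrite addrAC Gamma_rising// mulfK.
have [xp|xp] := pselect (Gamma_pole x).
  rewrite (Gamma_pole0 xp) invr0 mulr0; case: xp => q xq.
  have qm : (q < m)%N.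
    rewrite ltnNge; apply/negP => mq; apply: nn; split; last by exists q.
    by exists (q - m)%N; rewrite natrB// opprB xq addrC.
  by rewrite /rising (bigD1 (Ordinal qm))//= xq addNr mul0r.
rewrite Gamma_rising ?mulfK ?Gamma_neq0// => i _.
by apply/eqP => /eqP; rewrite addr_eq0 => /eqP xi; apply: xp; exists i.
Unshelve. all: by end_near. Qed.

(** Pairs at which the quotient has no pole: either Gamma y is finite, or the
    quotient is the polynomial [rising x m]. *)
Definition Gamma_ratio_regular y x := ~ Gamma_pole y \/ exists m : nat, y = x + m%:R.

Lemma Gamma_ratio_npole y x : ~ Gamma_pole y -> Gamma_ratio y x = Gamma y / Gamma x.
Proof. by move=> yp; rewrite /Gamma_ratio asboolF// => -[]. Qed.

Lemma Gamma_ratioS y x : Gamma_ratio_regular y x ->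
  Gamma_ratio (y + 1) x = y * Gamma_ratio y x.
Proof.
case=> [yp|[m ->]]; last first.
  by rewrite -addrA natr1 !Gamma_ratio_rising risingSr mulrC.
rewrite !Gamma_ratio_npole//; last first.
  move=> [m ym]; apply: yp; exists m.+1.
  by rewrite -natr1 opprD -ym addrK.
rewrite GammaS ?mulrA//; apply/eqP => y0; apply: yp; exists 0%N.
by rewrite y0 oppr0.
Qed.

Lemma Gamma_ratioSr y x : Gamma_ratio_regular y (x + 1) ->
  Gamma_ratio y x = x * Gamma_ratio y (x + 1).
Proof.
case=> [yp|[m ->]]; last first.
  by rewrite Gamma_ratio_rising -addrA [1 + _]addrC natr1 Gamma_ratio_rising risingSl.
rewrite !Gamma_ratio_npole//; have [->|x0] := eqVneq x 0.
  have p0 : Gamma_pole (0 : R) by exists 0%N; rewrite oppr0.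
  by rewrite mul0r (Gamma_pole0 p0) invr0 mulr0.
by rewrite GammaS// invfM mulrCA mulVKf.
Qed.

(** With a = j - w and b = k - w', all three eigenvalues are polynomial multiples
    of Gamma(a + gamma) / Gamma(a + 1) * Gamma(b + gamma - 1) / Gamma(b).  These
    two quotients have no pole: if a + gamma or b + gamma - 1 is a pole, then
    integrality of w - w' makes gamma a positive integer, and then the
    arguments of each quotient differ by a natural number. *)
Lemma intertwining_eigenvalueE (n j k : nat) (gamma w w' : R) :
  0 < gamma -> w + w' + n%:R + 1 = gamma -> w - w' \is a Num.int ->
  let mu := intertwining_eigenvalue (gamma - 1) (w - 1) w' j k in
  [/\ intertwining_eigenvalue gamma w w' j k =
        (j%:R - w) * (k%:R - w' + gamma - 1) * mu,
      intertwining_eigenvalue gamma w w' j.+1 k =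
        (j%:R - w + gamma) * (k%:R - w' + gamma - 1) * mu &
      (0 < k)%N -> intertwining_eigenvalue gamma w w' j k.-1 =
        (j%:R - w) * (k%:R - w' - 1) * mu].
Proof.
move=> g0 wg wZ mu.
pose a := j%:R - w; pose b := k%:R - w'.
have [ra rb] : Gamma_ratio_regular (a + gamma) (a + 1) /\
    Gamma_ratio_regular (b + gamma - 1) b.
  have [gZ|gZ] := boolP (gamma \is a Num.int).
    have /natrP[[|m] gm] : gamma \is a Num.nat by rewrite -intrEge0// ltW.
      by move: g0; rewrite gm ltxx.
    by split; right; exists m; rewrite gm -natr1; ring.
  split; left=> -[m am]; move/negP: gZ; apply; rewrite -wg.
    have w'Z : w' \is a Num.int.
      have -> : w' = - (m%:R + n%:R + 1 + j%:R) by move: am; rewrite /a -wg; lra.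
      by rewrite rpredN !rpredD ?rpred_nat ?rpred1.
    have wZ' : w \is a Num.int by rewrite -[w](subrK w') rpredD.
    by rewrite !rpredD ?rpred_nat ?rpred1.
  have wZ' : w \is a Num.int.
    have -> : w = - (m%:R + n%:R + k%:R) by move: am; rewrite /b -wg; lra.
    by rewrite rpredN !rpredD ?rpred_nat ?rpred1.
  have w'Z : w' \is a Num.int by rewrite -[w'](subKr w) rpredB.
  by rewrite !rpredD ?rpred_nat ?rpred1.
pose f := Gamma_ratio (a + gamma) (a + 1); pose g := Gamma_ratio (b + gamma - 1) b.
have muE : mu = f * g.
  rewrite /mu /intertwining_eigenvalue /f /g /a /b; congr (Gamma_ratio _ _ * Gamma_ratio _ _); ring.
have ga : Gamma_ratio (j%:R + gamma - w) (j%:R - w) = a * f.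
  by rewrite -Gamma_ratioSr// /a addrAC.
have gb : Gamma_ratio (k%:R + gamma - w') (k%:R - w') = (b + gamma - 1) * g.
  rewrite -Gamma_ratioS// /b; congr Gamma_ratio; ring.
rewrite /intertwining_eigenvalue ga gb muE -/a -/b; split; first by ring.
  have -> : Gamma_ratio (j.+1%:R + gamma - w) (j.+1%:R - w) = (a + gamma) * f.
    rewrite -Gamma_ratioS// /a -natr1; congr Gamma_ratio; ring.
  by ring.
move=> k0; have -> : Gamma_ratio (k.-1%:R + gamma - w') (k.-1%:R - w') = (b - 1) * g.
  have := @Gamma_ratioSr (b + gamma - 1) (b - 1); rewrite subrK => <-//.
  rewrite /b -subn1 natrB//; congr Gamma_ratio; ring.
by ring.
Qed.

End GammaFunction.

(** * Bihomogeneous harmonic polynomials *)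

Section Poly.
Import -(notations) mpoly.
Variables (K : numFieldType) (N d : nat).
Local Notation poly := (mpoly.mpoly N K).
Local Notation "p @[ m ]" := (mcoeff m p) (at level 3, format "p @[ m ]").
Local Notation "''d_' i" := (mderiv i) (at level 2, i at level 2).
Local Notation var i := (mpolyX K (mnm1 i) : poly).
Variables (f g : 'I_d -> 'I_N).

(** Degree in the variables listed by [h].  Below, [f] and [g] list two disjoint
    groups of variables, the z_l and the conjugates of the z_l in one order or
    the other, so that each result also holds with the two groups exchanged. *)
Definition deg_in (h : 'I_d -> 'I_N) (m : multinom N) : nat := \sum_(l < d) m (h l).

(** Bidegree read off the monomials, which is stable under formal derivatives. *)
Definition bihom j k (p : poly) := forall m, p@[m] != 0 -> deg_in f m = j /\ deg_in g m = k.

Definition lap (p : poly) := \sum_(l < d) 'd_(f l) ('d_(g l) p).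

Lemma bihomD j k p q : bihom j k p -> bihom j k q -> bihom j k (p + q).
Proof.
move=> hp hq m; rewrite mcoeffD; have [p0|/hp//] := eqVneq p@[m] 0.
by rewrite p0 add0r => /hq.
Qed.

Lemma bihomZ j k c p : bihom j k p -> bihom j k (c *: p).
Proof.
move=> hp m; rewrite mcoeffZ => h; apply: hp; apply: contra h => /eqP->.
by rewrite mulr0.
Qed.

Lemma deg_inD h m1 m2 : deg_in h (mnm_add m1 m2) = (deg_in h m1 + deg_in h m2)%N.
Proof. by rewrite -big_split; apply: eq_bigr => l _; rewrite mnmDE. Qed.

Lemma bihomM j1 k1 j2 k2 p q : bihom j1 k1 p -> bihom j2 k2 q ->
  bihom (j1 + j2) (k1 + k2) (p * q).
Proof.
move=> hp hq m; rewrite mcoeffM => h.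
case: (pickP (fun k : bmultinom N (mdeg m).+1 * bmultinom N (mdeg m).+1 =>
    (m == mnm_add k.1 k.2) && (p@[k.1] * q@[k.2] != 0))); last first.
  move=> none; rewrite big1 ?eqxx// in h => k kE.
  by have := none k; rewrite kE/= => /negbFE/eqP.
move=> [m1 m2] /= /andP[/eqP mE h12].
move: h12; rewrite mulf_eq0 negb_or => /andP[/hp[a1 b1] /hq[a2 b2]].
by rewrite mE !deg_inD a1 b1 a2 b2.
Qed.

Lemma mcoeff_var i m : (var i)@[m] = (mnm1 i == m)%:R.
Proof. exact: mcoeffX. Qed.

Lemma deriv_var i j : 'd_i (var j) = (i == j)%:R.
Proof.
rewrite mderivX mnm1E eq_sym; case: eqP => [->|_]; last by rewrite scale0r.
rewrite scale1r; apply/mpolyP => m; rewrite mcoeffX mcoeff1 eq_sym.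
by congr ((m == _)%:R); apply/mnmP => k; rewrite mnmBE mnm0E subnn.
Qed.

Lemma deriv_varM i j p : 'd_i (var j * p) = (i == j)%:R * p + var j * 'd_i p.
Proof. by rewrite mderivM deriv_var. Qed.

Lemma coef_euler i p m : (var i * 'd_i p)@[m] = p@[m] *+ m i.
Proof.
have [mi0|mi] := posnP (m i).
  rewrite mi0 mulr0n [LHS]mcoeffM big1// => -[m1 m2] /= /eqP mE.
  rewrite mcoeff_var; case: eqP => [e|_]; last by rewrite mul0r.
  by have := congr1 (fun m : multinom N => m i) mE; rewrite mi0 mnmDE -e mnm1E eqxx.
have mE : m = mnm_add (mnm_sub m (mnm1 i)) (mnm1 i).
  apply/mnmP => k; rewrite mnmDE mnmBE mnm1E; case: eqP => [<-|_].
    by rewrite subnK.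
  by rewrite subn0 addn0.
rewrite mulrC [in LHS]mE addmC mcoeffMX mcoeff_deriv -mE; congr (_ *+ _).
by rewrite mnmBE mnm1E eqxx subn1 prednK.
Qed.

Lemma euler_identity h p k : (forall m, p@[m] != 0 -> deg_in h m = k) ->
  \sum_(l < d) var (h l) * 'd_(h l) p = p *+ k.
Proof.
move=> hp; apply/mpolyP => m; rewrite (raddf_sum (mcoeff m)) mcoeffMn/=.
under eq_bigr => l _ do rewrite coef_euler.
rewrite sumrMnr -/(deg_in h m).
by have [->|/hp->//] := eqVneq p@[m] 0; rewrite !mul0rn.
Qed.

Hypotheses (f_inj : injective f) (g_inj : injective g) (fg : forall l r, f l != g r).

Lemma deg_in1 h i : deg_in h (mnm1 i) = (\sum_(l < d) (i == h l))%N.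
Proof. by apply: eq_bigr => l _; rewrite mnm1E. Qed.

Lemma deg_in1_inj h l : injective h -> deg_in h (mnm1 (h l)) = 1%N.
Proof.
move=> hi; rewrite deg_in1 (bigD1 l)//= eqxx big1// => r rl.
by rewrite (inj_eq hi) eq_sym (negPf rl).
Qed.

Lemma bihom_varf l : bihom 1 0 (var (f l)).
Proof.
move=> m; rewrite mcoeff_var; case: (mnm1 _ =P m) => [<- _|]; last by rewrite eqxx.
rewrite deg_in1_inj//; split=> //.
by rewrite deg_in1 big1// => r _; rewrite (negPf (fg _ _)).
Qed.

Lemma bihom_varg l : bihom 0 1 (var (g l)).
Proof.
move=> m; rewrite mcoeff_var; case: (mnm1 _ =P m) => [<- _|]; last by rewrite eqxx.
rewrite deg_in1_inj//; split=> //.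
by rewrite deg_in1 big1// => r _; rewrite eq_sym (negPf (fg _ _)).
Qed.

Lemma bihom_deriv j k p l : bihom j k.+1 p -> bihom j k ('d_(g l) p).
Proof.
move=> hp m; rewrite mcoeff_deriv => h.
have /hp[] : p@[mnm_add m (mnm1 (g l))] != 0.
  by apply: contra h => /eqP->; rewrite mul0rn.
rewrite !deg_inD deg_in1_inj// addn1 => a [b]; split=> //.
rewrite -a deg_in1 big1 ?addn0// => r _.
by rewrite eq_sym (negPf (fg _ _)).
Qed.

Lemma deriv_bihom0 j p l : bihom j 0 p -> 'd_(g l) p = 0.
Proof.
move=> hp; apply/mpolyP => m; rewrite mcoeff0 mcoeff_deriv.
have [->|/hp[_]] := eqVneq p@[mnm_add m (mnm1 (g l))] 0; first by rewrite mul0rn.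
by rewrite deg_inD deg_in1_inj// addn1.
Qed.

Lemma lapD p q : lap (p + q) = lap p + lap q.
Proof. by rewrite -big_split; apply: eq_bigr => l _; rewrite !mderivD. Qed.

Lemma lapZ c p : lap (c *: p) = c *: lap p.
Proof. by rewrite scaler_sumr; apply: eq_bigr => l _; rewrite !mderivZ. Qed.

Lemma lap_deriv i p : lap ('d_i p) = 'd_i (lap p).
Proof.
rewrite [RHS](raddf_sum (mderiv i)); apply: eq_bigr => l _.
by rewrite (mderiv_comm i) mderiv_comm.
Qed.

Lemma lap_var l p : lap (var (f l) * p) = var (f l) * lap p + 'd_(g l) p.
Proof.
rewrite /lap (bigD1 l)//= [in RHS](bigD1 l)//= mulrDr addrAC; congr (_ + _).
  by rewrite deriv_varM eq_sym (negPf (fg _ _)) mul0r add0r deriv_varM eqxx mul1r addrC.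
rewrite mulr_sumr; apply: eq_bigr => r rl.
rewrite deriv_varM eq_sym (negPf (fg _ _)) mul0r add0r deriv_varM.
by rewrite (inj_eq f_inj) (negPf rl) mul0r add0r.
Qed.

(** The polynomial |z|^2. *)
Definition rho : poly := \sum_(l < d) var (f l) * var (g l).

Lemma bihom_rho : bihom 1 1 rho.
Proof.
rewrite /rho; elim/big_ind: _ => [m|p q|l _]; first by rewrite mcoeff0 eqxx.
  exact: bihomD.
exact: (bihomM (@bihom_varf l) (@bihom_varg l)).
Qed.

Lemma deriv_rho_g l : 'd_(g l) rho = var (f l).
Proof.
rewrite /rho (raddf_sum (mderiv (g l))) (bigD1 l)//= big1 ?addr0 => [|r rl].
  by rewrite deriv_varM eq_sym (negPf (fg _ _)) mul0r add0r deriv_var eqxx mulr1.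
rewrite deriv_varM eq_sym (negPf (fg _ _)) mul0r add0r deriv_var.
by rewrite (inj_eq g_inj) eq_sym (negPf rl) mulr0.
Qed.

Lemma deriv_rho_f l : 'd_(f l) rho = var (g l).
Proof.
rewrite /rho (raddf_sum (mderiv (f l))) (bigD1 l)//= big1 ?addr0 => [|r rl].
  by rewrite deriv_varM eqxx mul1r deriv_var (negPf (fg _ _)) mulr0 addr0.
rewrite deriv_varM deriv_var (negPf (fg _ _)) mulr0 addr0.
by rewrite (inj_eq f_inj) eq_sym (negPf rl) mul0r.
Qed.

(** The cross terms of the Leibniz rule are the two Euler operators. *)
Lemma lap_rho j k p : bihom j k p -> lap (rho * p) = p *+ (d + j + k) + rho * lap p.
Proof.
move=> hp.
have e1 := @euler_identity f p j (fun m h => (hp m h).1).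
have e2 := @euler_identity g p k (fun m h => (hp m h).2).
rewrite !mulrnDr -e1 -e2 /lap mulr_sumr.
have -> : p *+ d = \sum_(l < d) p by rewrite sumr_const card_ord.
rewrite -!big_split; apply: eq_bigr => l _ /=.
rewrite mderivM deriv_rho_g mderivD deriv_varM eqxx mul1r mderivM deriv_rho_f.
by rewrite !addrA.
Qed.

(** The harmonic projection of z_l p: subtracting a multiple of |z|^2 dp/dzbar_l
    cancels the Laplacian dp/dzbar_l of z_l p, for the value of c in
    [harmonic_part_lap]. *)
Definition harmonic_part l c p := var (f l) * p - c *: (rho * 'd_(g l) p).

Lemma harmonic_part_bihom j k p l c :
  bihom j k p -> bihom j.+1 k (harmonic_part l c p).
Proof.
move=> hp; rewrite /harmonic_part -scaleNr; apply: bihomD.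
  exact: (bihomM (@bihom_varf l) hp).
apply: bihomZ; case: k hp => [|k] hp.
  by rewrite (@deriv_bihom0 _ _ _ hp) mulr0 => m; rewrite mcoeff0 eqxx.
exact: (bihomM bihom_rho (@bihom_deriv _ _ _ l hp)).
Qed.

Lemma harmonic_part_lap j k p l c : c * (d + j + k.-1)%:R = 1 ->
  bihom j k p -> lap p = 0 -> lap (harmonic_part l c p) = 0.
Proof.
move=> hc hp p0; rewrite /harmonic_part -scaleNr lapD lapZ lap_var p0 mulr0 add0r.
case: k hp hc => [|k] hp hc.
  rewrite (@deriv_bihom0 _ _ _ hp) mulr0 add0r /lap big1 ?scaler0// => r _.
  by rewrite !mderiv0.
rewrite (lap_rho (@bihom_deriv _ _ _ l hp)) lap_deriv p0 mderiv0 mulr0 addr0.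
by rewrite -scaler_nat scalerA mulNr hc scaleN1r addrN.
Qed.

End Poly.

Lemma lapC (K : numFieldType) N d (f g : 'I_d -> 'I_N) (p : mpoly.mpoly N K) :
  lap f g p = lap g f p.
Proof. by apply: eq_bigr => l _; rewrite mpoly.mderiv_comm. Qed.

Lemma bihomC (K : numFieldType) N d (f g : 'I_d -> 'I_N) j k (p : mpoly.mpoly N K) :
  bihom f g j k p -> bihom g f k j p.
Proof. by move=> h m /h[]. Qed.

Section PowerSums.
Variable K : numFieldType.

(** A polynomial with infinitely many roots is zero. *)
Lemma power_sum_component (T : Type) (s : seq T) (c : T -> K) (e : T -> nat)
    (c0 : K) (j : nat) (r : nat -> K) : injective r ->
  (forall i, \sum_(t <- s) c t * r i ^+ e t = c0 * r i ^+ j) ->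
  forall q, \sum_(t <- s | e t == q) c t = (q == j)%:R * c0.
Proof.
move=> r_inj h q.
pose P : {poly K} := \sum_(t <- s) (c t)%:P * 'X^(e t) - c0%:P * 'X^j.
have P0 : P = 0.
  apply: (@roots_geq_poly_eq0 _ _ (map r (iota 0 (size P)))).
  - apply/allP => _ /mapP[i _ ->]; rewrite /root /P hornerD hornerN horner_sum.
    by rewrite hornerM hornerC hornerXn -h subr_eq0; apply/eqP/eq_bigr => t _;
      rewrite hornerM hornerC hornerXn.
  - by rewrite map_inj_uniq ?iota_uniq.
  - by rewrite size_map size_iota.
have := congr1 (fun P : {poly K} => P`_q) P0.
rewrite /P coefB coef_sum coefCM coefXn coef0 => /subr0_eq.
rewrite mulrC => <-; rewrite [LHS]big_mkcond; apply: eq_bigr => t _ /=.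
by rewrite coefCM coefXn eq_sym; case: eqP => _; rewrite ?mulr1 ?mulr0.
Qed.

End PowerSums.

(** * Bidegree of a polynomial in z and its conjugate *)

Section ZPoly.
Import -(notations) mpoly.
Variables (R : realType) (n : nat).
Local Notation C := R[i].
Implicit Types (p : zpoly (R := R) n) (z : 'rV[C]_n.+1).
Let f (l : 'I_n.+1) := lshift n.+1 l.
Let g (l : 'I_n.+1) := rshift n.+1 l.

Definition zcoords z : 'I_(n.+1 + n.+1) -> C := fun i => row_mx z (map_mx Num.conj z) 0 i.

(** Infinitely many complex numbers of modulus 1. *)
Definition unit_seq (i : nat) : C := (i%:R +i* 1) / (i%:R +i* 1)^*.

Lemma unit_seq_den i : (i%:R +i* 1 : C) != 0.
Proof. by rewrite eq_complex/= oner_eq0 andbF. Qed.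

Lemma unit_seq_norm i : `|unit_seq i| = 1.
Proof. by rewrite /unit_seq normf_div norm_conjC divff// normr_eq0 unit_seq_den. Qed.

Lemma unit_seq_inj : injective unit_seq.
Proof.
move=> s t; rewrite /unit_seq => /eqP; rewrite eqr_div ?conjC_eq0 ?unit_seq_den//.
rewrite eq_complex/= => /andP[_ /eqP h]; apply/eqP; rewrite -(eqr_nat R).
by apply/eqP; move: h; lra.
Qed.

Lemma monomial_scale z a (m : multinom (n.+1 + n.+1)) :
  \prod_i zcoords (a *: z) i ^+ m i =
  a ^+ deg_in f m * (Num.conj a) ^+ deg_in g m * \prod_i zcoords z i ^+ m i.
Proof.
rewrite !big_split_ord/=.
rewrite mulrACA; congr (_ * _).
  rewrite expr_sum -big_split; apply: eq_bigr => l _ /=.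
  by rewrite -exprMn /zcoords !row_mxEl !mxE.
rewrite expr_sum -big_split; apply: eq_bigr => l _ /=.
by rewrite -exprMn /zcoords !row_mxEr !mxE rmorphM.
Qed.

Lemma lshift_coord_inj : injective f. Proof. exact: lshift_inj. Qed.
Lemma rshift_coord_inj : injective g. Proof. exact: rshift_inj. Qed.
Lemma shift_neq l r : f l != g r. Proof. by rewrite eq_lrshift. Qed.

(** The mixed derivative lowers the bidegree of every monomial by (1, 1), so the
    Laplacian acts separately on the components of each bidegree. *)
Lemma bideg_bump j k m l :
  let m' := mnm_add (mnm_add m (mnm1 (f l))) (mnm1 (g l)) in
  (deg_in f m' == j) && (deg_in g m' == k) =
  ((deg_in f m).+1 == j) && ((deg_in g m).+1 == k).
Proof.
have e1 : deg_in f (mnm1 (g l)) = 0%N.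
  by rewrite deg_in1 big1// => r _; rewrite eq_sym (negPf (shift_neq _ _)).
have e2 : deg_in g (mnm1 (f l)) = 0%N.
  by rewrite deg_in1 big1// => r _; rewrite (negPf (shift_neq _ _)).
rewrite /= !deg_inD e1 e2 !deg_in1_inj ?addn0 ?addn1//.
  exact: rshift_coord_inj.
exact: lshift_coord_inj.
Qed.

Definition bidegree_part j k p : zpoly (R := R) n :=
  \sum_(m <- msupp p | (deg_in f m == j) && (deg_in g m == k)) mcoeff m p *: mpolyX C m.

Lemma mcoeff_bidegree_part j k p m : mcoeff m (bidegree_part j k p) =
  if (deg_in f m == j) && (deg_in g m == k) then mcoeff m p else 0.
Proof.
rewrite /bidegree_part (raddf_sum (mcoeff m))/=.
under eq_bigr => m' _ do rewrite mcoeffZ mcoeffX.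
have [mp|mp] := boolP (m \in msupp p).
  rewrite big_mkcond (bigD1_seq m)//= eqxx mulr1 big1 ?addr0// => m' m'm.
  by rewrite (negPf m'm) mulr0 if_same.
rewrite memN_msupp_eq0// if_same big1_seq// => m' /andP[_ m'p].
by case: eqP => [e|_]; rewrite ?mulr0//; rewrite -e m'p in mp.
Qed.

Lemma bidegree_part_bihom j k p : bihom f g j k (bidegree_part j k p).
Proof.
by move=> m; rewrite mcoeff_bidegree_part; case: andP => [[/eqP-> /eqP->]|]; rewrite ?eqxx.
Qed.

Lemma bidegree_part_lap j k p : lap f g p = 0 -> lap f g (bidegree_part j k p) = 0.
Proof.
move=> p0; apply/mpolyP => m; rewrite mcoeff0 /lap (raddf_sum (mcoeff m))/=.
have := congr1 (mcoeff m) p0; rewrite mcoeff0 /lap (raddf_sum (mcoeff m))/= => p0m.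
have [jk|jk] := boolP (((deg_in f m).+1 == j) && ((deg_in g m).+1 == k)).
  rewrite -[RHS]p0m; apply: eq_bigr => l _; rewrite !mcoeff_deriv mcoeff_bidegree_part.
  by rewrite bideg_bump jk.
apply: big1 => l _; rewrite !mcoeff_deriv mcoeff_bidegree_part.
by rewrite bideg_bump (negPf jk) !mul0rn.
Qed.

Lemma zeval_bidegree_part j k p z : zeval (bidegree_part j k p) z =
  \sum_(m <- msupp p | (deg_in f m == j) && (deg_in g m == k))
     mcoeff m p * \prod_i zcoords z i ^+ m i.
Proof.
rewrite /zeval /bidegree_part raddf_sum/=; apply: eq_bigr => m _.
by rewrite mevalZ mevalX.
Qed.

(** Evaluate at a z with a = r w and |w| = 1.  For fixed w, comparing powers of
    the real number r isolates the monomials of total degree j + k.  Among these,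
    letting w^2 run through infinitely many points of the unit circle and
    comparing powers of w^2 isolates degree j in z.  Hence the other components
    contribute 0 at every point. *)
Lemma zeval_bihomogeneous j k p z : bihomogeneous j k p ->
  zeval p z = zeval (bidegree_part j k p) z.
Proof.
move=> hp; rewrite zeval_bidegree_part.
pose c m := mcoeff m p * \prod_i zcoords z i ^+ m i.
have hc a : \sum_(m <- msupp p) c m * (a ^+ deg_in f m * (Num.conj a) ^+ deg_in g m) =
    a ^+ j * (Num.conj a) ^+ k * zeval p z.
  rewrite -hp /zeval mevalE; apply: eq_bigr => m _.
  rewrite -[X in _ = _ * X]/(\prod_i zcoords (a *: z) i ^+ m i) monomial_scale /c.
  by rewrite -mulrA; congr (_ * _); rewrite mulrC.
pose s := [seq m <- msupp p | deg_in f m + deg_in g m == j + k]%N.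
have step u : `|u| = 1 -> \sum_(m <- s) c m * u ^+ deg_in f m = zeval p z * u ^+ j.
  (* A square root of u has modulus 1, and w^(2 d) = w^(d + e) w^d conj(w)^e. *)
  move=> u1; pose w := sqrtC u.
  have ww : w * Num.conj w = 1.
    by rewrite -normCK -normrX sqrtCK.
  have r_inj : injective (fun i : nat => i%:R : C).
    by move=> a b /eqP; rewrite eqr_nat => /eqP.
  have /(power_sum_component r_inj)/(_ (j + k)%N) : forall i : nat, \sum_(m <- msupp p)
      (c m * (w ^+ deg_in f m * (Num.conj w) ^+ deg_in g m)) * i%:R ^+ (deg_in f m + deg_in g m) =
      (w ^+ j * (Num.conj w) ^+ k * zeval p z) * i%:R ^+ (j + k).
    move=> i; have := hc (i%:R * w); rewrite !exprMn.
    have -> : Num.conj (i%:R * w : C) = i%:R * Num.conj w by rewrite rmorphM/= conjC_nat.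
    rewrite !exprMn => h.
    transitivity (i%:R ^+ j * w ^+ j * (i%:R ^+ k * Num.conj w ^+ k) * zeval p z).
      rewrite -h; by apply: eq_bigr => m _; rewrite !exprMn exprD; ring.
    by rewrite exprD; ring.
  rewrite eqxx mul1r => h.
  have uw : u = w * w by rewrite -expr2 sqrtCK.
  have wp a b : w ^+ (a + b) * (w ^+ a * Num.conj w ^+ b) = u ^+ a.
    by rewrite uw exprD exprMn -[RHS]mulr1 -(expr1n _ b) -ww exprMn; ring.
  rewrite -(wp j k) mulrCA [zeval p z * _]mulrC -h mulr_sumr big_filter.
  apply: eq_bigr => m /eqP <-; rewrite -(wp _ (deg_in g m)); ring.
have := @power_sum_component C _ s c (deg_in f) (zeval p z) j unit_seq unit_seq_inj
  (fun i => step _ (unit_seq_norm i)) j.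
rewrite eqxx mul1r => <-; rewrite big_filter_cond; apply: eq_bigl => m.
case: (deg_in f m =P j) => [->|]; last by rewrite andbF.
by rewrite andbT eqn_add2l.
Qed.

End ZPoly.

(** * Multiplication by coordinates on the harmonic spaces *)

Section HarmonicSpaces.
Import -(notations) mpoly.
Variables (R : realType) (n : nat).
Local Notation C := R[i].
Local Notation f := (fun l : 'I_n.+1 => lshift n.+1 l).
Local Notation g := (fun l : 'I_n.+1 => rshift n.+1 l).
Local Notation sphere := (sphere (R := R) n).
Implicit Types (p : zpoly (R := R) n) (z : sphere) (u v : sphere -> C).
Local Notation var i := (mpolyX C (mnm1 i) : zpoly (R := R) n).

Lemma sphere_normE z : \sum_l sphere_coord l z * (sphere_coord l z)^* = 1.
Proof.
have /eqP <- := valP z; apply: eq_bigr => l _.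
by rewrite /sphere_coord -normCK.
Qed.

Lemma zeval_varl l (z : 'rV[C]_n.+1) : zeval (var (f l)) z = z 0 l.
Proof. by rewrite /zeval mevalXU row_mxEl. Qed.

Lemma zeval_varr l (z : 'rV[C]_n.+1) : zeval (var (g l)) z = (z 0 l)^*.
Proof. by rewrite /zeval mevalXU row_mxEr mxE. Qed.

Lemma zevalM p q (z : 'rV[C]_n.+1) : zeval (p * q) z = zeval p z * zeval q z.
Proof. exact: mevalM. Qed.

Lemma zeval_rho z : zeval (rho C f g) (\val z) = 1.
Proof.
rewrite -(sphere_normE z) /zeval /rho raddf_sum/=; apply: eq_bigr => l _.
have := zevalM (var (f l)) (var (g l)) (\val z); rewrite /zeval => ->.
by rewrite -/(zeval _ _) zeval_varl -/(zeval _ _) zeval_varr.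
Qed.

Lemma rhoC : rho C g f = rho C f g :> zpoly (R := R) n.
Proof. by apply: eq_bigr => l _; rewrite mulrC. Qed.

Lemma harmonicE p : Defs.harmonic p <-> lap f g p = 0.
Proof.
rewrite /Defs.harmonic -[X in _ *: X]/(lap f g p); split => [/eqP|->]; last exact: scaler0.
by rewrite scaler_eq0 pnatr_eq0 => /eqP.
Qed.

Lemma bihom_harmonic_space j k p : bihom f g j k p -> lap f g p = 0 ->
  harmonic_space j k (fun z => zeval p (\val z)).
Proof.
move=> hp p0; exists p; split=> //; last first.
  by rewrite harmonicE.
move=> a z; rewrite /zeval !mevalE mulr_sumr; apply: eq_big_seq => m.
rewrite mcoeff_msupp => /hp[<- <-].
rewrite -[X in _ * X = _]/(\prod_i zcoords (a *: z) i ^+ m i) monomial_scale.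
rewrite mulrCA; congr (_ * _).
Qed.

Lemma harmonic_space_bihom j k u : harmonic_space j k u ->
  exists p, [/\ bihom f g j k p, lap f g p = 0 & u = fun z => zeval p (\val z)].
Proof.
move=> [p [hp p0 up]]; exists (bidegree_part j k p); split.
- exact: bidegree_part_bihom.
- by apply: bidegree_part_lap; rewrite -harmonicE.
- by apply/funext => z; rewrite up (zeval_bihomogeneous _ hp).
Qed.

(** The constant is n + 1 + j + (k - 1): it is n + j + k for k > 0, and it stays
    nonzero for k = 0, when the second component is 0. *)
Lemma mul_coord_decomposition j k u : harmonic_space j k u ->
  exists h d : 'I_n.+1 -> sphere -> C,
  [/\ forall l, harmonic_space j.+1 k (h l),
      forall l, if k is k'.+1 then harmonic_space j k' (d l) else d l = fun=> 0,
      forall l z, sphere_coord l z * u z = h l z + ((n.+1 + j + k.-1)%:R)^-1 * d l z &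
      forall z, \sum_l (sphere_coord l z)^* * d l z = k%:R * u z].
Proof.
move=> /harmonic_space_bihom[p [hp p0 ->]].
pose c : C := (n.+1 + j + k.-1)%:R^-1.
have hc : c * (n.+1 + j + k.-1)%:R = 1 by rewrite mulVf// pnatr_eq0.
exists (fun l z => zeval (harmonic_part f g l c p) (\val z)).
exists (fun l z => zeval (mderiv (g l) p) (\val z)); split.
- move=> l; apply: bihom_harmonic_space.
    by apply: harmonic_part_bihom hp;
      [exact: lshift_inj|exact: rshift_inj|move=> *; rewrite eq_lrshift].
  by apply: harmonic_part_lap hc hp p0;
      [exact: lshift_inj|exact: rshift_inj|move=> *; rewrite eq_lrshift].
- move=> l; case: k hp @c hc => [|k] hp _ _.
    have -> : mderiv (g l) p = 0.
      by apply: deriv_bihom0 hp; [exact: rshift_inj].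
    by apply/funext => z; rewrite /zeval raddf0.
  apply: bihom_harmonic_space; last by rewrite lap_deriv p0 mderiv0.
  by apply: bihom_deriv hp; [exact: rshift_inj|move=> *; rewrite eq_lrshift].
- move=> l z; rewrite /harmonic_part.
  rewrite /zeval mevalB mevalZ !mevalM -!/(zeval _ _) zeval_rho mul1r zeval_varl.
  by rewrite subrK.
- move=> z.
  have := @euler_identity C (n.+1 + n.+1) n.+1 g p k (fun m h => (hp m h).2).
  move=> /(congr1 (fun q => zeval q (\val z))); rewrite /zeval mevalMn raddf_sum/= mulr_natl => <-.
  by apply: eq_bigr => l _; rewrite mevalM -!/(zeval _ _) zeval_varr.
Qed.

Lemma mul_coordC_decomposition j k u : harmonic_space j k u ->
  exists h d : 'I_n.+1 -> sphere -> C,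
  [/\ forall l, harmonic_space j k.+1 (h l),
      forall l, if j is j'.+1 then harmonic_space j' k (d l) else d l = fun=> 0 &
      forall l z, (sphere_coord l z)^* * u z = h l z + ((n.+1 + k + j.-1)%:R)^-1 * d l z].
Proof.
move=> /harmonic_space_bihom[p [hp p0 ->]].
pose c : C := (n.+1 + k + j.-1)%:R^-1.
have hc : c * (n.+1 + k + j.-1)%:R = 1 by rewrite mulVf// pnatr_eq0.
have hp' := bihomC hp; have p0' : lap g f p = 0 by rewrite lapC.
exists (fun l z => zeval (harmonic_part g f l c p) (\val z)).
exists (fun l z => zeval (mderiv (f l) p) (\val z)); split.
- move=> l; apply: bihom_harmonic_space.
    apply: bihomC.
    by apply: harmonic_part_bihom hp';
      [exact: rshift_inj|exact: lshift_inj|move=> *; rewrite eq_rlshift].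
  rewrite lapC.
  by apply: harmonic_part_lap hc hp' p0';
      [exact: rshift_inj|exact: lshift_inj|move=> *; rewrite eq_rlshift].
- move=> l; case: j hp hp' @c hc => [|j] hp hp' _ _.
    have -> : mderiv (f l) p = 0.
      by apply: deriv_bihom0 hp'; [exact: lshift_inj].
    by apply/funext => z; rewrite /zeval raddf0.
  apply: bihom_harmonic_space; last by rewrite lap_deriv p0 mderiv0.
  by apply: bihomC; apply: bihom_deriv hp'; [exact: lshift_inj|move=> *; rewrite eq_rlshift].
- move=> l z; rewrite /harmonic_part rhoC.
  rewrite /zeval mevalB mevalZ !mevalM -!/(zeval _ _) zeval_rho mul1r zeval_varr.
  by rewrite subrK.
Qed.

End HarmonicSpaces.

(** * Smooth functions *)

Section SmoothFunctions.
Variables (R : realType) (m : nat).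
Implicit Types F G : 'rV[R]_m -> R.

Lemma CkS k F : Ck k.+1 F -> Ck k F.
Proof.
elim: k F => [|k IH] F [cF dF DF] //; split=> // i; exact/IH/DF.
Qed.

Lemma Ck_cst k (c : R) : Ck k (fun _ : 'rV[R]_m => c).
Proof.
elim: k c => [|k IH] c /=; first exact: cst_continuous.
split=> [|i x|i]; first exact: cst_continuous.
  exact: derivable_cst.
have -> : (fun x => 'D_(delta_mx 0 i) (fun _ : 'rV[R]_m => c) x) = fun=> 0.
  by apply/funext => x; apply: derive_cst.
exact: IH.
Qed.

Lemma CkD k F G : Ck k F -> Ck k G -> Ck k (fun x => F x + G x).
Proof.
elim: k F G => [|k IH] F G /= hF hG; first by move=> x; exact: (cvgD (hF x) (hG x)).
case: hF hG => [cF dF DF] [cG dG DG]; split.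
- by move=> x; exact: (cvgD (cF x) (cG x)).
- by move=> i x; exact: (derivableD (dF i x) (dG i x)).
- move=> i; have -> : (fun x => 'D_(delta_mx 0 i) (fun x => F x + G x) x) =
      (fun x => 'D_(delta_mx 0 i) F x + 'D_(delta_mx 0 i) G x).
    by apply/funext => x; apply: deriveD.
  exact: IH.
Qed.

Lemma CkM k F G : Ck k F -> Ck k G -> Ck k (fun x => F x * G x).
Proof.
elim: k F G => [|k IH] F G /= hF hG; first by move=> x; exact: (cvgM (hF x) (hG x)).
have kF := CkS hF; have kG := CkS hG.
case: hF hG => [cF dF DF] [cG dG DG]; split.
- by move=> x; exact: (cvgM (cF x) (cG x)).
- by move=> i x; exact: (derivableM (dF i x) (dG i x)).
- move=> i; have -> : (fun x => 'D_(delta_mx 0 i) (fun x => F x * G x) x) =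
      (fun x => F x * 'D_(delta_mx 0 i) G x + G x * 'D_(delta_mx 0 i) F x).
    by apply/funext => x; apply: deriveM.
  by apply: CkD; apply: IH.
Qed.

(** The derivative of a coordinate is constant. *)
Lemma Ck_coord k (i : 'I_m) : Ck k (fun x : 'rV[R]_m => x 0 i).
Proof.
have cc : continuous (fun x : 'rV[R]_m => x 0 i) by exact: coord_continuous.
have dv (v x : 'rV[R]_m) : is_derive x v (fun x : 'rV[R]_m => x 0 i) (v 0 i).
  have h : (h^-1 *: ((h *: v + x) 0 i - x 0 i)) @[h --> (0 : R)^'] --> (v 0 i : R^o).
    apply: cvg_near_cst; near=> h; apply/eqP.
    have h0 : h != 0 by near: h; exact: nbhs_dnbhs_neq.
    by rewrite !mxE addrK scalerA mulVf// scale1r.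
  have d : derivable (fun x : 'rV[R]_m => x 0 i) x v by apply/cvg_ex; exists (v 0 i).
  by apply: DeriveDef => //; exact: cvg_lim.
case: k => [|k] //; split=> // j.
have -> : (fun x => 'D_(delta_mx 0 j) (fun x : 'rV[R]_m => x 0 i) x) =
    (fun=> (delta_mx 0 j : 'rV[R]_m) 0 i).
  by apply/funext => x; apply: derive_val.
exact: Ck_cst.
Unshelve. all: by end_near. Qed.

Lemma smooth_cst (c : R) : smooth (fun _ : 'rV[R]_m => c).
Proof. by move=> k; exact: Ck_cst. Qed.

Lemma smooth_coord (i : 'I_m) : smooth (fun x : 'rV[R]_m => x 0 i).
Proof. by move=> k; exact: Ck_coord. Qed.

Lemma smoothD F G : smooth F -> smooth G -> smooth (fun x => F x + G x).
Proof. by move=> hF hG k; exact: CkD. Qed.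

Lemma smoothM F G : smooth F -> smooth G -> smooth (fun x => F x * G x).
Proof. by move=> hF hG k; exact: CkM. Qed.

Lemma smoothN F : smooth F -> smooth (fun x => - F x).
Proof.
move=> hF; rewrite (_ : (fun x => _) = fun x => -1 * F x); first exact/smoothM/hF/smooth_cst.
by apply/funext => x; rewrite mulN1r.
Qed.

Lemma smooth_continuous F : smooth F -> continuous F.
Proof. by move=> /(_ 0%N). Qed.

End SmoothFunctions.

Section SphereSmooth.
Variables (R : realType) (n : nat).
Local Notation C := R[i].
Local Notation sphere := (sphere (R := R) n).
Implicit Types (u v : sphere -> C) (z : sphere).

Lemma sphere_smooth_cst (c : C) : sphere_smooth (fun _ : sphere => c).
Proof.
exists (fun=> complex.Re c), (fun=> complex.Im c); split; [exact: smooth_cst..|].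
by move=> z; case: c.
Qed.

Lemma sphere_smoothD u v : sphere_smooth u -> sphere_smooth v ->
  sphere_smooth (fun z => u z + v z).
Proof.
move=> [F [G [sF sG uE]]] [F' [G' [sF' sG' vE]]].
exists (fun x => F x + F' x), (fun x => G x + G' x); split; [exact: smoothD..|].
by move=> z; rewrite uE vE.
Qed.

Lemma sphere_smoothM u v : sphere_smooth u -> sphere_smooth v ->
  sphere_smooth (fun z => u z * v z).
Proof.
move=> [F [G [sF sG uE]]] [F' [G' [sF' sG' vE]]].
exists (fun x => F x * F' x + - (G x * G' x)), (fun x => F x * G' x + G x * F' x); split.
- by apply: smoothD; [|apply: smoothN]; exact: smoothM.
- by apply: smoothD; exact: smoothM.
- by move=> z; rewrite uE vE.
Qed.

Lemma sphere_smooth_conj u : sphere_smooth u -> sphere_smooth (fun z => (u z)^*).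
Proof.
move=> [F [G [sF sG uE]]]; exists F, (fun x => - G x); split=> //; first exact: smoothN.
by move=> z; rewrite uE.
Qed.

Lemma sphere_smooth_sum (I : Type) (s : seq I) (P : pred I) (u : I -> sphere -> C) :
  (forall i, sphere_smooth (u i)) -> sphere_smooth (fun z => \sum_(i <- s | P i) u i z).
Proof.
move=> h; elim: s => [|a s IH].
  by under eq_fun do rewrite big_nil; exact: sphere_smooth_cst.
under eq_fun do rewrite big_cons; case: (P a) => //.
exact: sphere_smoothD.
Qed.

Lemma sphere_smoothX u k : sphere_smooth u -> sphere_smooth (fun z => u z ^+ k).
Proof.
move=> h; elim: k => [|k IH]; first exact: sphere_smooth_cst.
by under eq_fun do rewrite exprS; exact: sphere_smoothM.
Qed.

Lemma sphere_smooth_prod (I : Type) (s : seq I) (u : I -> sphere -> C) :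
  (forall i, sphere_smooth (u i)) -> sphere_smooth (fun z => \prod_(i <- s) u i z).
Proof.
move=> h; elim: s => [|a s IH].
  by under eq_fun do rewrite big_nil; exact: sphere_smooth_cst.
by under eq_fun do rewrite big_cons; exact: sphere_smoothM.
Qed.

Lemma sphere_smooth_coord l : sphere_smooth (sphere_coord l : sphere -> C).
Proof.
exists (fun x : 'rV[R]_(n.+1 + n.+1) => x 0 (lshift _ l)),
  (fun x : 'rV[R]_(n.+1 + n.+1) => x 0 (rshift _ l)).
split; [exact: smooth_coord..|move=> z].
by rewrite /real_coords row_mxEl row_mxEr !mxE /sphere_coord; case: (\val z 0 l).
Qed.

Lemma harmonic_space_smooth j k u : harmonic_space j k u -> sphere_smooth u.
Proof.
move=> [p [_ _ /funext ->]]; rewrite /zeval.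
under eq_fun do rewrite mpoly.mevalE.
apply: sphere_smooth_sum => m; apply: sphere_smoothM; first exact: sphere_smooth_cst.
apply: sphere_smooth_prod => i; apply: sphere_smoothX.
case: (split_ordP i) => l ->.
  by under eq_fun do rewrite row_mxEl; exact: sphere_smooth_coord.
under eq_fun do rewrite row_mxEr mxE.
exact: (sphere_smooth_conj (sphere_smooth_coord l)).
Qed.

End SphereSmooth.

(** * Geometry and integration on the sphere *)

Section SphereGeometry.
Variables (R : realType) (n : nat).
Local Notation C := R[i].
Local Notation sphere := (sphere (R := R) n).
Local Notation N := (n.+1 + n.+1)%N.
Implicit Types (u v : sphere -> C) (z a : sphere).

Definition sphere_pt z : 'rV[R]_N := real_coords (\val z).
Definition rdot z a : R := \sum_i sphere_pt z 0 i * sphere_pt a 0 i.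
Definition hdot z a : C := \sum_l sphere_coord l z * (sphere_coord l a)^*.

Lemma rdotE z a : rdot z a = complex.Re (hdot z a).
Proof.
rewrite /hdot (raddf_sum (@complex.Re R : {additive C -> R})) /rdot big_split_ord/= -big_split.
apply: eq_bigr => l _ /=; rewrite /sphere_pt /real_coords !row_mxEl !row_mxEr !mxE /sphere_coord.
by case: (\val z 0 l) (\val a 0 l) => x y [x' y'] /=; rewrite mulrN opprK.
Qed.

Lemma rdot_self z : rdot z z = 1.
Proof. by rewrite rdotE /hdot sphere_normE. Qed.

Lemma rdot_dist z a : \sum_i (sphere_pt z 0 i - sphere_pt a 0 i) ^+ 2 = 2 * (1 - rdot z a).
Proof.
transitivity (rdot z z - 2 * rdot z a + rdot a a); last by rewrite !rdot_self; ring.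
rewrite /rdot mulr_sumr -sumrB -big_split; apply: eq_bigr => i _ /=; ring.
Qed.

Lemma sphere_pt_box z i : -1 <= sphere_pt z 0 i <= 1.
Proof.
rewrite -ler_norml -(@ler_pXn2r _ 2)// ?nnegrE// expr1n real_normK ?num_real//.
rewrite -(rdot_self z) /rdot (bigD1 i)//= -expr2 lerDl sumr_ge0// => r _.
by rewrite -expr2 sqr_ge0.
Qed.

(** Equal to 1 at a and to less than 1 elsewhere on the sphere; 4 (1 - peak a z) is
    the squared distance from z to a. *)
Definition peak a z : R := (1 + rdot z a) / 2.

Lemma peak_dist a z : \sum_i (sphere_pt z 0 i - sphere_pt a 0 i) ^+ 2 = 4 * (1 - peak a z).
Proof. by rewrite rdot_dist /peak; field. Qed.

Lemma rdot_geN1 z a : -1 <= rdot z a.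
Proof.
have : 0 <= rdot z z + 2 * rdot z a + rdot a a.
  rewrite /rdot mulr_sumr -!big_split sumr_ge0// => i _ /=.
  by have := sqr_ge0 (sphere_pt z 0 i + sphere_pt a 0 i); rewrite sqrrD -mulr_natl !expr2 mulrA.
by rewrite !rdot_self; lra.
Qed.

Lemma peak_ge0 a z : 0 <= peak a z.
Proof. by have := rdot_geN1 z a; rewrite /peak; lra. Qed.

Lemma peakE a z : (peak a z)%:C = 2^-1 + 4^-1 *
  \sum_l (sphere_coord l z * (sphere_coord l a)^* + (sphere_coord l z)^* * sphere_coord l a).
Proof.
have -> : \sum_l (sphere_coord l z * (sphere_coord l a)^* +
    (sphere_coord l z)^* * sphere_coord l a) =
    hdot z a + (hdot z a)^*.
  rewrite big_split /hdot; congr (_ + _); rewrite (rmorph_sum (Num.conj : {rmorphism C -> C})).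
  by apply: eq_bigr => l _; rewrite rmorphM/= conjCK.
rewrite /peak rdotE; case: (hdot z a) => x y /=.
have -> : (x +i* y) + (x -i* y) = (2 * x)%:C.
  by apply/eqP; rewrite eq_complex/= subrr eqxx andbT; apply/eqP; ring.
have natC (k : nat) : (k%:R^-1 : C) = (k%:R^-1)%:C by rewrite fmorphV/= rmorph_nat.
rewrite !natC -rmorphM -rmorphD/=; congr (_%:C); by field.
Qed.

Lemma peak_close a z r : 0 < r -> 1 - peak a z < r ^+ 2 / 4 ->
  ball (sphere_pt a) r (sphere_pt z).
Proof.
move=> r0 h; split=> // i j; rewrite -ball_normE /= (ord1 i).
rewrite -(@ltr_pXn2r _ 2)// ?nnegrE// ?ltW// real_normK ?num_real//.
apply: (@le_lt_trans _ _ (4 * (1 - peak a z))); last by lra.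
rewrite -peak_dist (bigD1 j)//= -[X in _ <= X + _]sqrrN opprB lerDl.
by apply: sumr_ge0 => l _; exact: sqr_ge0.
Qed.

Lemma close_peak a z d : 0 < d -> ball (sphere_pt a) (Num.min 1 d / n.+1%:R) (sphere_pt z) ->
  1 - d < peak a z.
Proof.
move=> d0 [r0 h]; set r := _ / _ in r0 h.
have sum_le : \sum_i (sphere_pt z 0 i - sphere_pt a 0 i) ^+ 2 <= r ^+ 2 * (2 * n.+1%:R).
  have -> : r ^+ 2 * (2 * n.+1%:R) = \sum_(i < N) r ^+ 2.
    by rewrite sumr_const card_ord [RHS]mulrnDr -mulr_natr; ring.
  apply: ler_sum => i _; have := h 0 i; rewrite -ball_normE /= => hi.
  by rewrite -[leLHS]sqrrN opprB -real_normK ?num_real// ler_pXn2r ?nnegrE// ltW.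
have n0 : 0 < n.+1%:R :> R by [].
have n1 : 1 <= n.+1%:R :> R by rewrite ler1n.
have rn : r * n.+1%:R = Num.min 1 d by rewrite /r divfK ?lt0r_neq0.
have m1 : Num.min 1 d <= 1 by rewrite ge_min lexx.
have m2 : Num.min 1 d <= d by rewrite ge_min lexx orbT.
have r1 : r <= 1 by rewrite -(ler_pM2r n0) rn mul1r (le_trans m1).
have : r ^+ 2 * (2 * n.+1%:R) <= 2 * d.
  have -> : r ^+ 2 * (2 * n.+1%:R) = 2 * (r * (r * n.+1%:R)) by ring.
  rewrite rn ler_pM2l// (le_trans _ m2)// -[leRHS]mul1r ler_wpM2r//.
  by rewrite -rn mulr_ge0// ltW.
by move: sum_le; rewrite peak_dist; lra.
Qed.

Definition box : set 'rV[R]_N := [set x | forall i, `[-1, 1]%classic (x 0 i)].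
Lemma box_compact : compact box.
Proof.
have : compact [set v : 'rV[R]_N | forall i, v ord0 i \in `[-1, 1]].
  apply: (@rV_compact R N (fun=> `[(-1), 1]%classic)).
  by move=> _; apply: segment_compact.
by [].
Qed.

Lemma box_sphere_pt z : box (sphere_pt z).
Proof. by move=> i; rewrite /= in_itv/= sphere_pt_box. Qed.

Lemma continuous_sphere_bounded (F : 'rV[R]_N -> R) : continuous F ->
  exists2 M, 0 < M & forall z, `|F (sphere_pt z)| <= M.
Proof.
move=> cF; have : compact (F @` box).
  by apply: continuous_compact box_compact; exact: continuous_subspaceT.
move=> /compact_bounded /pinfty_ex_gt0[M M0 hM]; exists M => // z.
by apply: hM; exists (sphere_pt z) => //; exact: box_sphere_pt.
Qed.

(** The Borel sets of the sphere are generated by traces of open sets. *)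
Lemma continuous_sphere_measurable (F : 'rV[R]_N -> R) : continuous F ->
  measurable_fun [set: borel_sphere n] (fun z : borel_sphere n => F (sphere_pt z)).
Proof.
move=> cF; apply: (measurability (@RGenOpens.G R)); first exact: RGenOpens.measurableE.
move=> _ [_ [x [y ->]] <-].
rewrite setTI; apply: sub_sigma_algebra.
exists (F @^-1` `]x, y[%classic) => //=.
apply: open_comp; last exact: interval_open.
by move=> t _; exact: cF.
Qed.

Variable sigma : probability (borel_sphere (R := R) n) R.

Lemma continuous_sphere_integrable (F : 'rV[R]_N -> R) : continuous F ->
  sigma.-integrable setT (EFin \o (fun z : borel_sphere n => F (sphere_pt z))).
Proof.
move=> cF; apply: measurable_bounded_integrable => //.
- by apply: (@le_lt_trans _ _ 1%E); [exact: probability_le1|exact: ltry].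
- exact: continuous_sphere_measurable.
- have [M M0 hM] := continuous_sphere_bounded cF.
  exists M; split; first exact: num_real.
  by move=> x Mx z _ /=; rewrite (le_trans (hM z))// ltW.
Qed.

End SphereGeometry.

(** * Positivity of the invariant measure on caps *)

Section Transitivity.
Variables (R : realType) (n : nat).
Local Notation C := R[i].
Local Notation sphere := (sphere (R := R) n).
Local Notation adj M := (map_mx Num.conj M^T).
Implicit Types (z a b : sphere).

Lemma on_sphereE (x : 'rV[C]_n.+1) : on_sphere x = ((x *m adj x) 0 0 == 1).
Proof.
rewrite /on_sphere mxE; congr (_ == 1); apply: eq_bigr => l _.
by rewrite !mxE normCK.
Qed.

Lemma hdotE z a : hdot z a = (\val z *m adj (\val a)) 0 0.
Proof. by rewrite mxE; apply: eq_bigr => l _; rewrite !mxE. Qed.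

(** Gram-Schmidt applied to the matrix all of whose rows are a returns a unitary
    matrix whose first row is a positive multiple of a, hence a itself. *)
Lemma unitary_row0 a : exists2 U : 'M[C]_n.+1, U \is unitarymx & row 0 U = \val a.
Proof.
pose A : 'M[C]_n.+1 := \matrix_(i, j) \val a 0 j.
have A0 : row 0 A = \val a by apply/rowP => j; rewrite !mxE.
exists (schmidt A); first exact: schmidt_unitarymx.
have := row_schmidt_sub A 0; rewrite A0 (big_pred1 0); last first.
  by move=> k /=; rewrite leqn0.
rewrite genmxE => /sub_rVP[c ac].
have := form1_row_schmidt A 0; rewrite A0.
have uu : (row 0 (schmidt A) *m adj (row 0 (schmidt A))) 0 0 = 1.
  have /row_unitarymxP/(_ 0 0) := schmidt_unitarymx A (leqnn _).
  by rewrite dotmxE eqxx.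
have aa : (\val a *m adj (\val a)) 0 0 = 1 by apply/eqP; rewrite -on_sphereE; exact: valP.
rewrite dotmxE ac -scalemxAl mxE uu mulr1 => c0.
move: aa; rewrite ac linearZ/= map_mxZ -scalemxAl -scalemxAr scalerA mxE uu mulr1.
rewrite [X in c * X](geC0_conj c0) -expr2 => /eqP; rewrite pexpr_eq1// => /eqP ->.
by rewrite scale1r.
Qed.

Lemma unitary_transitive a b : exists (U : 'M[C]_n.+1) (phi : sphere -> sphere),
  [/\ U \is unitarymx, forall z, \val (phi z) = \val z *m U & phi a = b].
Proof.
have [Ua uUa rUa] := unitary_row0 a; have [Ub uUb rUb] := unitary_row0 b.
pose U := adj Ua *m Ub.
have uU : U \is unitarymx.
  by apply: mul_unitarymx => //; rewrite trmxC_unitary.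
have sU z : on_sphere (\val z *m U).
  rewrite on_sphereE trmx_mul map_mxM -mulmxA (mulmxA U) (unitarymxP uU) mul1mx.
  by rewrite -on_sphereE; exact: valP.
exists U, (fun z => exist _ (\val z *m U) (sU z)); split=> //.
apply: val_inj => /=; rewrite /U mulmxA -rUa -row_mul.
by rewrite (unitarymxP uUa) -row_mul mul1mx.
Qed.

Lemma unitary_peak (U : 'M[C]_n.+1) (phi : sphere -> sphere) a z :
  U \is unitarymx -> (forall z, \val (phi z) = \val z *m U) ->
  peak (phi a) (phi z) = peak a z.
Proof.
move=> uU pU; rewrite /peak !rdotE !hdotE !pU.
by rewrite trmx_mul map_mxM -mulmxA (mulmxA U) (unitarymxP uU) mul1mx.
Qed.

End Transitivity.

Section Caps.
Variables (R : realType) (n : nat).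
Local Notation C := R[i].
Local Notation sphere := (sphere (R := R) n).
Local Notation N := (n.+1 + n.+1)%N.
Implicit Types (z a b : sphere).
Variable sigma : probability (borel_sphere (R := R) n) R.

Definition cap a (d : R) : set (borel_sphere (R := R) n) := [set z | 1 - d < peak a z].

Definition peak_fun a (x : 'rV[R]_N) : R := (1 + \sum_i x 0 i * sphere_pt a 0 i) / 2.

Lemma peak_fun_smooth a : smooth (peak_fun a).
Proof.
rewrite /peak_fun; apply: smoothM; last exact: smooth_cst.
apply: smoothD; first exact: smooth_cst.
elim: (index_enum _) => [|i s IH].
  by under eq_fun do rewrite big_nil; exact: smooth_cst.
under eq_fun do rewrite big_cons; apply: smoothD => //.
by apply: smoothM; [exact: smooth_coord|exact: smooth_cst].
Qed.

Lemma continuous_open_measurable (U : set 'rV[R]_N) : open U ->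
  measurable ((fun z : borel_sphere n => sphere_pt z) @^-1` U).
Proof. by move=> oU; apply: sub_sigma_algebra; exists U. Qed.

Lemma cap_measurable a d : measurable (cap a d).
Proof.
have -> : cap a d = (fun z => sphere_pt z) @^-1` ((peak_fun a) @^-1` `]1 - d, +oo[%classic).
  by apply/seteqP; split=> z /=; rewrite /cap/= in_itv/= andbT.
apply: continuous_open_measurable; apply: open_comp; last exact: interval_open.
by move=> x _; apply: smooth_continuous; exact: peak_fun_smooth.
Qed.

Hypothesis sigma_inv : unitary_invariant sigma.

Lemma cap_rot a b d : sigma (cap a d) = sigma (cap b d).
Proof.
have [U [phi [uU pU ab]]] := unitary_transitive a b.
rewrite -(sigma_inv uU pU (cap_measurable b d)); congr (sigma _).
by apply/seteqP; split=> z; rewrite /cap/= -ab (unitary_peak _ _ uU pU).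
Qed.

(** If one cap were null, then by rotation all caps of that size would be; balls
    of half the radius that meet the sphere lie in such caps, and finitely many
    balls cover the compact box around the sphere, which would make the total
    mass 0. *)
Lemma cap_pos a d : 0 < d -> (0 < sigma (cap a d))%E.
Proof.
move=> d0; rewrite lt0e measure_ge0 andbT; apply/negP => /eqP s0.
(* A sup-norm ball of this radius meets the sphere inside a cap of size d. *)
pose r : R := Num.min 1 d / n.+1%:R.
have r0 : 0 < r by rewrite divr_gt0// lt_min ltr01.
have := @box_compact R n; rewrite compact_cover => /(_ _ (@box R n) (fun x => ball x (r / 2))).
case=> [x _||D' _ hD].
  exact: ball_open.
  by move=> x bx; exists x => //; apply: ballxx; rewrite divr_gt0.
pose T x : set (borel_sphere (R := R) n) := (fun z => sphere_pt z) @^-1` ball x (r / 2).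
have mT x : measurable (T x).
  by apply: continuous_open_measurable; exact: ball_open.
have T0 x : sigma (T x) = 0%E.
  have [->|/set0P[y Ty]] := eqVneq (T x) set0; first exact: measure0.
  apply/eqP; rewrite -measure_le0 -(s0) (cap_rot a y).
  apply: le_measure; rewrite ?inE//; first exact: cap_measurable.
  move=> z Tz; apply: close_peak => //.
  rewrite -/r [r]splitr; apply: ball_triangle Tz.
  exact: ball_sym.
have S0 (s : seq 'rV[R]_N) : sigma (\big[setU/set0]_(x <- s) T x) = 0%E.
  elim: s => [|x s IH]; first by rewrite big_nil measure0.
  rewrite big_cons; apply/eqP; rewrite -measure_le0.
  set S := \big[setU/set0]_(_ <- _) _ in IH *.
  have mS : measurable S by exact: bigsetU_measurable.
  have : (sigma (T x `|` S) <= sigma (T x) + sigma S)%E by exact: measureU2.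
  by rewrite T0 IH adde0.
have : sigma setT = 0%E.
  apply/eqP; rewrite -measure_le0 -(S0 (finmap.enum_fset D')).
  apply: le_measure; rewrite ?inE//; first by apply: bigsetU_measurable.
  move=> z _; have [x xD zx] := hD _ (box_sphere_pt z).
  by rewrite -bigcup_seq; exists x.
by rewrite probability_setT => /eqP; rewrite onee_eq0.
Qed.

End Caps.

(** * Separation by powers of a peak function *)

Section PeakSeparation.
Variables (R : realType) (n : nat).
Local Notation C := R[i].
Local Notation sphere := (sphere (R := R) n).
Local Notation N := (n.+1 + n.+1)%N.
Implicit Types (z a b : sphere).
Variable sigma : probability (borel_sphere (R := R) n) R.
Hypothesis sigma_inv : unitary_invariant sigma.

Lemma smooth_mul_peak_continuous (F : 'rV[R]_N -> R) a m : continuous F ->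
  continuous (fun x => F x * peak_fun a x ^+ m).
Proof.
move=> cF; have sp : smooth (fun x => peak_fun a x ^+ m).
  elim: m => [|m IH]; first exact: smooth_cst.
  under eq_fun do rewrite exprS; apply: smoothM => //; exact: peak_fun_smooth.
have cp : continuous (fun x => peak_fun a x ^+ m) by exact: smooth_continuous.
by move=> x; exact: (cvgM (cF x) (cp x)).
Qed.

(** Near a, say where the peak function exceeds 1 - d, F is at least some e > 0.
    If all moments were 0, comparing the m-th one from below would give
    e c (1 - d/2)^m <= M (1 - d)^m for all m, with c the measure of the cap of size
    d/2 and M a bound of |F|; this is false for large m. *)
Lemma peak_moment_pos (F : 'rV[R]_N -> R) a : continuous F ->
  0 < F (sphere_pt a) ->
  exists m, \int[sigma]_z (F (sphere_pt z) * peak a z ^+ m) != 0.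
Proof.
move=> cF Fa; apply/not_existsP => /= all0.
have {}all0 m : \int[sigma]_z (F (sphere_pt z) * peak a z ^+ m) = 0.
  by apply/eqP/negPn/negP; exact: all0.
have [M M0 hM] := continuous_sphere_bounded cF.
pose e := F (sphere_pt a) / 2.
have e0 : 0 < e by rewrite divr_gt0.
have [r r0 hr] : exists2 r : R, 0 < r & forall x, ball (sphere_pt a) r x -> e < F x.
  have : \forall x \near sphere_pt a, e < F x.
    by have /cvgr_gt := cF (sphere_pt a); apply; rewrite /e; lra.
  by move=> /nbhs_ballP[r /= r0 h]; exists r.
(* 1 / 2 keeps 1 - d nonnegative; r ^ 2 / 4 puts the cap of size d in the ball of radius r. *)
pose d : R := Num.min (r ^+ 2 / 4) (1 / 2).
have d0 : 0 < d by rewrite lt_min divr_gt0// ?exprn_gt0//= divr_gt0.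
have d1 : d <= 1 / 2 by rewrite ge_min lexx orbT.
have dr : d <= r ^+ 2 / 4 by rewrite ge_min lexx.
have near_a z : 1 - d < peak a z -> e < F (sphere_pt z).
  by move=> h; apply: hr; apply: peak_close => //; lra.
pose c := fine (sigma (cap a (d / 2))).
have c0 : 0 < c.
  rewrite /c fine_gt0// cap_pos ?divr_gt0//=.
  by rewrite (le_lt_trans (probability_le1 _ _)) ?ltry//; exact: cap_measurable.
have key m : e * c * (1 - d / 2) ^+ m <= M * (1 - d) ^+ m.
  pose K := M * (1 - d) ^+ m; pose w := e * (1 - d / 2) ^+ m.
  have K0 : 0 <= K by rewrite mulr_ge0 ?exprn_ge0 ?ltW//; lra.
  have w0 : 0 <= w by rewrite mulr_ge0 ?exprn_ge0 ?ltW//; lra.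
  have int0 : sigma.-integrable setT
      (EFin \o (fun z : borel_sphere n => F (sphere_pt z) * peak a z ^+ m)).
    exact: (continuous_sphere_integrable sigma (@smooth_mul_peak_continuous F a m cF)).
  have intK : sigma.-integrable setT (EFin \o (fun=> K) : borel_sphere n -> \bar R).
    exact: (@continuous_sphere_integrable R n sigma (fun=> K) (@cst_continuous _ _ K)).
  have intK' : sigma.-integrable setT
      (EFin \o (fun z : borel_sphere n => F (sphere_pt z) * peak a z ^+ m + K)).
    have cFK : continuous (fun x => F x * peak_fun a x ^+ m + K).
      by move=> x; exact: (cvgD (@smooth_mul_peak_continuous F a m cF x) (@cst_continuous _ _ K x)).
    exact: (continuous_sphere_integrable sigma cFK).
  have mC := cap_measurable a (d / 2).
  have intw : sigma.-integrable setT (EFin \o ((fun=> w) \_ (cap a (d / 2)))).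
    rewrite -restrict_EFin -integrable_mkcond//.
    exact: finite_measure_integrable_cst.
  have : \int[sigma]_z ((fun=> w) \_ (cap a (d / 2))) z <=
         \int[sigma]_z (F (sphere_pt z) * peak a z ^+ m + K).
    apply: le_Rintegral => // z _.
    have s0 := peak_ge0 a z.
    have Fz : - M <= F (sphere_pt z) by have := hM z; rewrite ler_norml => /andP[].
    rewrite patchE; case: ifPn => [|_].
      rewrite inE /cap/= => zC; apply: ler_wpDr => //.
      apply: ler_pM; [exact: ltW|by rewrite exprn_ge0//; lra| |].
        by apply/ltW/near_a; lra.
      by apply: lerXn2r; rewrite ?nnegrE//; [lra|exact: ltW].
    (* Off the small cap: F is positive on the larger cap, and its negative
       part is dominated elsewhere. *)
    have [h|h] := ltP (1 - d) (peak a z).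
      by rewrite addr_ge0// mulr_ge0 ?exprn_ge0// ltW// (lt_trans e0)// near_a.
    rewrite -lerBlDr sub0r /K -mulNr; apply: (@le_trans _ _ (- M * peak a z ^+ m)).
      rewrite !mulNr lerN2 ler_pM2l// lerXn2r ?nnegrE//; lra.
    by rewrite ler_wpM2r ?exprn_ge0.
  rewrite -Rintegral_mkcond Rintegral_cst// RintegralD// all0 add0r Rintegral_cst//.
  have sT : fine (sigma setT) = 1 by rewrite probability_setT.
  by rewrite [X in K * X]sT mulr1 /w -/c mulrAC.
pose q := (1 - d) / (1 - d / 2).
have b0 : 0 < 1 - d / 2 by lra.
have q0 : 0 <= q by rewrite divr_ge0//; lra.
have q1 : q < 1 by rewrite ltr_pdivrMr// mul1r; lra.
have keyq m : e * c <= M * q ^+ m.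
  by rewrite /q expr_div_n mulrA ler_pdivlMr ?exprn_gt0.
have : (M * q ^+ m) @[m --> \oo] --> (0 : R).
  rewrite -(mulr0 M); apply: cvgM; first exact: cvg_cst.
  by apply: cvg_expr; rewrite ger0_norm.
move=> cq; have : e * c <= 0.
  rewrite -(cvg_lim _ cq)//; apply: limr_ge; first by apply/cvg_ex; exists 0.
  by near=> m; exact: keyq.
by rewrite leNgt mulr_gt0.
Unshelve. all: by end_near. Qed.

Lemma peak_separation (F : 'rV[R]_N -> R) a : continuous F ->
  (forall m, \int[sigma]_z (F (sphere_pt z) * peak a z ^+ m) = 0) ->
  F (sphere_pt a) = 0.
Proof.
move=> cF h; case: (ltgtP (F (sphere_pt a)) 0) => // Fa.
  have cNF : continuous (fun x => - F x) by move=> x; exact: (cvgN (cF x)).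
  have [|m /eqP[]] := @peak_moment_pos (fun x => - F x) a cNF.
    by rewrite oppr_gt0.
  have int0 : sigma.-integrable setT
      (EFin \o (fun z : borel_sphere n => F (sphere_pt z) * peak a z ^+ m)).
    exact: (continuous_sphere_integrable sigma (@smooth_mul_peak_continuous F a m cF)).
  transitivity (\int[sigma]_z (-1 * (F (sphere_pt z) * peak a z ^+ m))).
    by apply: eq_Rintegral => z _; rewrite mulN1r mulNr.
  by rewrite RintegralZl// h mulr0.
by have [m /eqP[]] := @peak_moment_pos F a cF Fa.
Qed.

End PeakSeparation.

(** * The inner product *)

Section Inner.
Variables (R : realType) (n : nat).
Local Notation C := R[i].
Local Notation sphere := (sphere (R := R) n).
Implicit Types (u v w : sphere -> C).
Variable sigma : probability (borel_sphere (R := R) n) R.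

Lemma sphere_smooth_integrable u : sphere_smooth u ->
  sigma.-integrable setT (EFin \o (fun z : borel_sphere n => complex.Re (u z))) /\
  sigma.-integrable setT (EFin \o (fun z : borel_sphere n => complex.Im (u z))).
Proof.
move=> [F [G [/smooth_continuous cF /smooth_continuous cG uE]]].
split.
  have -> : (fun z => complex.Re (u z)) = (fun z => F (sphere_pt z))
    by apply/funext => z; rewrite uE.
  exact: continuous_sphere_integrable.
have -> : (fun z => complex.Im (u z)) = (fun z => G (sphere_pt z)) by apply/funext => z; rewrite uE.
exact: continuous_sphere_integrable.
Qed.

Lemma cintegralD u v : sphere_smooth u -> sphere_smooth v ->
  cintegral sigma (fun z => u z + v z) = cintegral sigma u + cintegral sigma v.
Proof.
move=> /sphere_smooth_integrable[ru iu] /sphere_smooth_integrable[rv iv].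
rewrite /cintegral; apply/eqP; rewrite eq_complex/=; apply/andP; split; apply/eqP.
  rewrite -RintegralD//; apply: eq_Rintegral => z _; by case: (u z) (v z) => [? ?] [].
rewrite -RintegralD//; apply: eq_Rintegral => z _; by case: (u z) (v z) => [? ?] [].
Qed.

Lemma cintegralZ (a : C) u : sphere_smooth u ->
  cintegral sigma (fun z => a * u z) = a * cintegral sigma u.
Proof.
move=> /sphere_smooth_integrable[ru iu]; case: a => x y.
have ZR (f : sphere -> R) (r : R) : sigma.-integrable setT (EFin \o f) ->
    sigma.-integrable setT (EFin \o (fun z => r * f z)).
  move=> fi; have := integrableZl measurableT r fi.
  by rewrite (_ : (fun x => _) = EFin \o (fun z => r * f z)).
rewrite /cintegral; apply/eqP; rewrite eq_complex/=; apply/andP; split; apply/eqP.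
  rewrite -mulNr -!RintegralZl// -RintegralD//; [|exact: ZR..].
  by apply: eq_Rintegral => z _; case: (u z) => p q /=; rewrite mulNr.
rewrite -!RintegralZl// -RintegralD//; [|exact: ZR..].
by apply: eq_Rintegral => z _; case: (u z).
Qed.

Lemma innerDl u v w : sphere_smooth u -> sphere_smooth v -> sphere_smooth w ->
  inner sigma (fun z => u z + v z) w = inner sigma u w + inner sigma v w.
Proof.
move=> su sv sw; rewrite /inner -cintegralD; last 2 first.
- exact: (sphere_smoothM su (sphere_smooth_conj sw)).
- exact: (sphere_smoothM sv (sphere_smooth_conj sw)).
by congr cintegral; apply/funext => z; rewrite mulrDl.
Qed.

Lemma innerZl a u w : sphere_smooth u -> sphere_smooth w ->
  inner sigma (fun z => a * u z) w = a * inner sigma u w.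
Proof.
move=> su sw; rewrite /inner -cintegralZ; last exact: (sphere_smoothM su (sphere_smooth_conj sw)).
by congr cintegral; apply/funext => z; rewrite mulrA.
Qed.

Lemma innerDr u v w : sphere_smooth u -> sphere_smooth v -> sphere_smooth w ->
  inner sigma w (fun z => u z + v z) = inner sigma w u + inner sigma w v.
Proof.
move=> su sv sw; rewrite /inner -cintegralD; last 2 first.
- exact: (sphere_smoothM sw (sphere_smooth_conj su)).
- exact: (sphere_smoothM sw (sphere_smooth_conj sv)).
by congr cintegral; apply/funext => z; rewrite rmorphD mulrDr.
Qed.

Lemma innerZr (r : R) u w : sphere_smooth u -> sphere_smooth w ->
  inner sigma w (fun z => r%:C * u z) = r%:C * inner sigma w u.
Proof.
move=> su sw; rewrite /inner -cintegralZ; last exact: (sphere_smoothM sw (sphere_smooth_conj su)).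
congr cintegral; apply/funext => z; rewrite rmorphM mulrCA; congr (_ * _).
by apply/eqP; rewrite eq_complex/= oppr0 !eqxx.
Qed.

Lemma inner_suml (I : Type) (s : seq I) (u : I -> sphere -> C) w :
  (forall i, sphere_smooth (u i)) -> sphere_smooth w ->
  inner sigma (fun z => \sum_(i <- s) u i z) w = \sum_(i <- s) inner sigma (u i) w.
Proof.
move=> su sw; elim: s => [|i s IH].
  rewrite big_nil; under eq_fun do rewrite big_nil -(mul0r 1).
  by rewrite innerZl ?mul0r//; exact: sphere_smooth_cst.
rewrite big_cons -IH -innerDl//; last exact: sphere_smooth_sum.
by under eq_fun do rewrite big_cons.
Qed.

Lemma inner0r w : sphere_smooth w -> inner sigma w (fun=> 0) = 0.
Proof.
move=> sw; have := @innerZr 0 (fun=> 1) w (@sphere_smooth_cst R n 1) sw.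
have -> : (fun z : sphere => 0%:C * 1) = fun=> (0 : C) by apply/funext => z; rewrite mul0r.
by rewrite mul0r.
Qed.

Lemma inner_sumr (I : Type) (s : seq I) (u : I -> sphere -> C) w :
  (forall i, sphere_smooth (u i)) -> sphere_smooth w ->
  inner sigma w (fun z => \sum_(i <- s) u i z) = \sum_(i <- s) inner sigma w (u i).
Proof.
move=> su sw; elim: s => [|i s IH].
  rewrite big_nil; under eq_fun do rewrite big_nil; exact: inner0r.
rewrite big_cons -IH -innerDr//; last exact: sphere_smooth_sum.
by under eq_fun do rewrite big_cons.
Qed.

Lemma inner_mulCl p u v : inner sigma (fun z => (p z)^* * u z) v =
  inner sigma u (fun z => p z * v z).
Proof.
by rewrite /inner; congr cintegral; apply/funext => z; rewrite rmorphM/= mulrCA mulrA.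
Qed.

Lemma inner_mull p u v : inner sigma (fun z => p z * u z) v =
  inner sigma u (fun z => (p z)^* * v z).
Proof.
rewrite /inner; congr cintegral; apply/funext => z.
by rewrite rmorphM/= [X in _ * (X * _)](conjCK (p z)) mulrCA mulrA.
Qed.

End Inner.

(** * Finite sums of harmonics *)

Section HarmonicSums.
Import -(notations) mpoly.
Variables (R : realType) (n : nat).
Local Notation C := R[i].
Local Notation sphere := (sphere (R := R) n).
Implicit Types (u v w : sphere -> C).

Inductive harmonic_sum : (sphere -> C) -> Prop :=
| harmonic_sum_harmonic j k u : harmonic_space j k u -> harmonic_sum u
| harmonic_sum_comb (a : C) u v : harmonic_sum u -> harmonic_sum v ->
    harmonic_sum (fun z => a * u z + v z).

Lemma harmonic_sum_smooth u : harmonic_sum u -> sphere_smooth u.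
Proof.
elim=> [j k {}u|a {}u v _ su _ sv]; first exact: harmonic_space_smooth.
by apply: sphere_smoothD => //; apply: sphere_smoothM => //; exact: sphere_smooth_cst.
Qed.

Lemma harmonic_sum1 : harmonic_sum (fun=> 1).
Proof.
have -> : (fun=> 1) = (fun z : sphere => zeval (@mpoly.mpolyC (n.+1 + n.+1) C 1) (\val z)).
  by apply/funext => z; rewrite /zeval mpoly.mevalC.
apply: (@harmonic_sum_harmonic 0 0); apply: bihom_harmonic_space.
  move=> m; rewrite mpoly.mcoeffC mul1r; case: (m =P _) => [-> _|]; last by rewrite eqxx.
  by split; apply: big1 => l _; rewrite mpoly.mnm0E.
by apply: big1 => l _; rewrite mpoly.mderivC mpoly.mderiv0.
Qed.

Lemma harmonic_sum0 : harmonic_sum (fun=> 0).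
Proof.
have -> : (fun=> 0) = (fun z : sphere => -1 * 1 + 1 : C) by apply/funext => z; rewrite mulr1 addNr.
by apply: harmonic_sum_comb; exact: harmonic_sum1.
Qed.

Lemma harmonic_sumZ a u : harmonic_sum u -> harmonic_sum (fun z => a * u z).
Proof.
move=> hu; have := harmonic_sum_comb a hu harmonic_sum0.
by under eq_fun do rewrite addr0.
Qed.

Lemma harmonic_sumD u v : harmonic_sum u -> harmonic_sum v -> harmonic_sum (fun z => u z + v z).
Proof.
move=> hu hv; have := harmonic_sum_comb 1 hu hv.
by under eq_fun do rewrite mul1r.
Qed.

Lemma harmonic_sum_sum (I : Type) (s : seq I) (u : I -> sphere -> C) :
  (forall i, harmonic_sum (u i)) -> harmonic_sum (fun z => \sum_(i <- s) u i z).
Proof.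
move=> hu; elim: s => [|i s IH].
  by under eq_fun do rewrite big_nil; exact: harmonic_sum0.
by under eq_fun do rewrite big_cons; exact: harmonic_sumD.
Qed.

(** Both components of z_l u are harmonic. *)
Lemma harmonic_sum_coord l u : harmonic_sum u ->
  harmonic_sum (fun z => sphere_coord l z * u z).
Proof.
elim=> [j k {}u hu|a {}u v _ hu _ hv]; last first.
  have := harmonic_sum_comb a hu hv.
  by under eq_fun do rewrite mulrCA -mulrDr.
have [h [d [hh hd uE _]]] := mul_coord_decomposition hu.
under eq_fun do rewrite uE addrC; apply: harmonic_sum_comb; last exact/harmonic_sum_harmonic/hh.
move: hd => /(_ l); case: k {hh uE hu} => [->|k]; first exact: harmonic_sum0.
exact: harmonic_sum_harmonic.
Qed.

Lemma harmonic_sum_coordC l u : harmonic_sum u ->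
  harmonic_sum (fun z => (sphere_coord l z)^* * u z).
Proof.
elim=> [j k {}u hu|a {}u v _ hu _ hv]; last first.
  have := harmonic_sum_comb a hu hv.
  by under eq_fun do rewrite mulrCA -mulrDr.
have [h [d [hh hd uE]]] := mul_coordC_decomposition hu.
under eq_fun do rewrite uE addrC; apply: harmonic_sum_comb; last exact/harmonic_sum_harmonic/hh.
move: hd => /(_ l); case: j {hh uE hu} => [->|j]; first exact: harmonic_sum0.
exact: harmonic_sum_harmonic.
Qed.

(** The peak function is a combination of 1, the coordinates and their conjugates. *)
Lemma harmonic_sum_peak a m : harmonic_sum (fun z => (peak a z ^+ m)%:C).
Proof.
elim: m => [|m IH]; first exact: harmonic_sum1.
have -> : (fun z => (peak a z ^+ m.+1)%:C) = (fun z : sphere => 2^-1 * (peak a z ^+ m)%:C +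
    \sum_l (4^-1 * (sphere_coord l a)^* * (sphere_coord l z * (peak a z ^+ m)%:C) +
            4^-1 * sphere_coord l a * ((sphere_coord l z)^* * (peak a z ^+ m)%:C))).
  apply/funext => z; rewrite exprS rmorphM/= peakE mulrDl; congr (_ + _).
  rewrite mulr_sumr mulr_suml; apply: eq_bigr => l _; ring.
apply: harmonic_sumD; first exact: harmonic_sumZ.
apply: harmonic_sum_sum => l; apply: harmonic_sumD; apply: harmonic_sumZ.
  exact: harmonic_sum_coord.
exact: harmonic_sum_coordC.
Qed.

End HarmonicSums.

(** * The commutator identity *)

Section Operator.
Variables (R : realType) (n : nat).
Local Notation C := R[i].
Local Notation sphere := (sphere (R := R) n).
Implicit Types (u v : sphere -> C).
Variable sigma : probability (borel_sphere (R := R) n) R.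
Hypothesis sigma_inv : unitary_invariant sigma.
Variables (gamma w w' : R) (A B : (sphere -> C) -> (sphere -> C)).
Hypotheses (g0 : 0 < gamma) (wg : w + w' + n%:R + 1 = gamma) (wZ : w - w' \is a Num.int).
Hypothesis (hA : normalized_intertwining sigma gamma w w' A).
Hypothesis (hB : normalized_intertwining sigma (gamma - 1) (w - 1) w' B).

Let kappa : R := gamma * (gamma - 1 - w').

(** For k > 0, lambda j k.-1 - lambda j.+1 k is - gamma (n + 1 + j + (k - 1))
    times the eigenvalue of B, which cancels the denominator of c. *)
Lemma eigenvalue_balance j k :
  let lambda := intertwining_eigenvalue gamma w w' in
  let c := (n.+1 + j + k.-1)%:R^-1 in
  lambda j.+1 k + c * k%:R * (lambda j k.-1 - lambda j.+1 k) - lambda j k =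
  kappa * intertwining_eigenvalue (gamma - 1) (w - 1) w' j k.
Proof.
move=> lambda c; have [e0 e1 e2] := intertwining_eigenvalueE j k g0 wg wZ.
rewrite /lambda e0 e1 /kappa; case: k @c e2 {e0 e1} => [|k] c e2.
  by rewrite mulr0 mul0r; ring.
rewrite (e2 isT) /=; set D := (n.+1 + j + k)%:R in c *.
have D0 : D != 0 by rewrite pnatr_eq0.
have DE : D = n%:R + 1 + j%:R + k%:R by rewrite /D !natrD -natr1.
set mu := intertwining_eigenvalue _ _ _ _ _.
have -> : (j%:R - w) * (k.+1%:R - w' - 1) * mu -
    (j%:R - w + gamma) * (k.+1%:R - w' + gamma - 1) * mu = - (gamma * mu) * D.
  by rewrite DE -wg -natr1; ring.
have cD : c * D = 1 by rewrite /c mulVf.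
have -> : c * k.+1%:R * (- (gamma * mu) * D) = - (k.+1%:R * gamma * mu) * (c * D) by ring.
by rewrite cD -natr1; ring.
Qed.

(** The difference of the two sides of the commutator identity, with
    sum_l conj(z_l) z_l = 1 already used to expand the commutator. *)
Definition defect u (z : sphere) : C :=
  \sum_l (sphere_coord l z)^* * A (fun y => sphere_coord l y * u y) z +
  ((-1)%:C * A u z + (- kappa)%:C * B u z).

Lemma smooth_coord_mul l u : sphere_smooth u -> sphere_smooth (fun y => sphere_coord l y * u y).
Proof. by move=> su; apply: sphere_smoothM => //; exact: sphere_smooth_coord. Qed.

Lemma defectE u z : defect u z =
  \sum_l (sphere_coord l z)^* * coord_commutator A l u z - kappa%:C * B u z.
Proof.
rewrite /defect addrA [(- kappa)%:C]rmorphN mulNr; congr (_ - _).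
under [in RHS]eq_bigr do rewrite /coord_commutator mulrBr mulrA.
rewrite sumrB; congr (_ + _).
rewrite -mulr_suml (eq_bigr (fun l => sphere_coord l z * (sphere_coord l z)^*)); last first.
  by move=> l _; rewrite mulrC.
by rewrite sphere_normE mul1r rmorphN rmorph1 mulN1r.
Qed.

Lemma defect_smooth u : sphere_smooth u -> sphere_smooth (defect u).
Proof.
case: hA hB => sA _ _ _ [sB _ _ _] su.
apply: sphere_smoothD.
  apply: sphere_smooth_sum => l; apply: sphere_smoothM.
    exact/sphere_smooth_conj/sphere_smooth_coord.
  exact/sA/smooth_coord_mul.
by apply: sphere_smoothD; apply: sphere_smoothM;
  [exact: sphere_smooth_cst|exact: sA|exact: sphere_smooth_cst|exact: sB].
Qed.

Lemma defect_comb a u v : sphere_smooth u -> sphere_smooth v ->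
  defect (fun z => a * u z + v z) = (fun z => a * defect u z + defect v z).
Proof.
case: hA hB => sA lA _ _ [sB lB _ _] su sv.
apply/funext => z; rewrite /defect lA// lB//.
under eq_bigr => l _.
  have -> : (fun y => sphere_coord l y * (a * u y + v y)) =
    (fun y => a * (sphere_coord l y * u y) + sphere_coord l y * v y).
    by apply/funext => y; ring.
  rewrite lA ?mulrDr; [|exact: smooth_coord_mul..].
  over.
rewrite big_split/= [a * (_ + _)]mulrDr mulr_sumr.
under eq_bigr do rewrite mulrCA.
ring.
Qed.

(** Multiplications by z_l and by its conjugate are adjoint to each other, so
    conj(z_l) A z_l is its own adjoint. *)
Lemma defect_selfadjoint u v : sphere_smooth u -> sphere_smooth v ->
  inner sigma (defect u) v = inner sigma u (defect v).
Proof.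
case: hA hB => sA lA aA _ [sB lB aB _] su sv.
have sc l t : sphere_smooth t -> sphere_smooth (fun z =>
    (sphere_coord l z)^* * A (fun y => sphere_coord l y * t y) z).
  move=> st; apply: sphere_smoothM; first exact/sphere_smooth_conj/sphere_smooth_coord.
  exact/sA/smooth_coord_mul.
have sZA (a : C) t : sphere_smooth t -> sphere_smooth (fun z => a * A t z).
  by move=> st; apply: sphere_smoothM; [exact: sphere_smooth_cst|exact: sA].
have sZB (a : C) t : sphere_smooth t -> sphere_smooth (fun z => a * B t z).
  by move=> st; apply: sphere_smoothM; [exact: sphere_smooth_cst|exact: sB].
have ss t : sphere_smooth t -> sphere_smooth (fun z => \sum_l (sphere_coord l z)^* *
    A (fun y => sphere_coord l y * t y) z).
  by move=> st; apply: sphere_smooth_sum => l; exact: sc.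
have sl t : sphere_smooth t -> sphere_smooth (fun z => (-1)%:C * A t z + (- kappa)%:C * B t z).
  by move=> st; apply: sphere_smoothD; [exact: sZA|exact: sZB].
rewrite /defect (innerDl sigma (ss _ su) (sl _ su) sv) (innerDr sigma (ss _ sv) (sl _ sv) su).
congr (_ + _).
  rewrite (inner_suml _ _ _ sv) => [|l]; last exact: sc.
  rewrite (inner_sumr _ _ _ su) => [|l]; last exact: sc.
  apply: eq_bigr => l _; rewrite inner_mulCl aA ?inner_mull//; exact: smooth_coord_mul.
rewrite (innerDl sigma (sZA _ _ su) (sZB _ _ su) sv) (innerDr sigma (sZA _ _ sv) (sZB _ _ sv) su).
rewrite !(innerZl _ _ _ sv) ?(innerZr _ _ _ su); [|by [exact: sA|exact: sB]..].
by rewrite aA// aB.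
Qed.

(** Each z_l u is a combination of two eigenfunctions of A; contracting with the
    conjugate coordinates turns both back into multiples of u. *)
Lemma defect_harmonic j k u : harmonic_space j k u -> defect u = fun=> 0.
Proof.
case: hA hB => sA lA aA eA [sB lB aB eB] hu.
have [h [d [hh hd uE dE]]] := mul_coord_decomposition hu.
apply/funext => z; rewrite /defect (eA _ _ _ hu) (eB _ _ _ hu).
pose c : R := (n.+1 + j + k.-1)%:R^-1.
(* The zero function is the second component for k = 0; linearity applies to
   it in the form -1 * 1 + 1. *)
have A0 : A (fun=> 0) = fun=> 0.
  have s1 := @sphere_smooth_cst R n 1.
  have := lA (-1) _ _ s1 s1.
  have -> : (fun z : sphere => -1 * 1 + 1) = (fun=> 0 : C) by apply/funext => y; ring.
  by move=> ->; apply/funext => y; ring.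
have Ad l : A (d l) = fun y => (intertwining_eigenvalue gamma w w' j k.-1)%:C * d l y.
  move: hd => /(_ l); case: (k) => [->|k']; last exact: eA.
  by rewrite A0; apply/funext => y; rewrite mulr0.
have sd l : sphere_smooth (d l).
  move: hd => /(_ l); case: (k) => [->|k']; first exact: sphere_smooth_cst.
  exact: harmonic_space_smooth.
have cE : ((n.+1 + j + k.-1)%:R^-1 : C) = c%:C by rewrite fmorphV/= rmorph_nat.
under eq_bigr => l _.
  have -> : (fun y => sphere_coord l y * u y) = (fun y => c%:C * d l y + h l y).
    by apply/funext => y; rewrite uE cE addrC.
  rewrite lA ?Ad ?(eA _ _ _ (hh l)); [|exact: sd|exact: harmonic_space_smooth (hh l)].
  have -> : h l z = sphere_coord l z * u z - c%:C * d l z by rewrite uE cE addrK.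
  set l1 := intertwining_eigenvalue _ _ _ j.+1 k; set l2 := intertwining_eigenvalue _ _ _ j k.-1.
  have -> : (sphere_coord l z)^* * (c%:C * (l2%:C * d l z) +
       l1%:C * (sphere_coord l z * u z - c%:C * d l z)) =
     l1%:C * u z * (sphere_coord l z * (sphere_coord l z)^*) +
     c%:C * (l2%:C - l1%:C) * ((sphere_coord l z)^* * d l z) by ring.
  over.
rewrite big_split/= -!mulr_sumr sphere_normE dE mulr1.
have := eigenvalue_balance j k; cbv zeta; rewrite -/c.
set l1 := intertwining_eigenvalue _ _ _ j.+1 k; set l2 := intertwining_eigenvalue _ _ _ j k.-1.
set l0 := intertwining_eigenvalue gamma w w' j k; set mu := intertwining_eigenvalue _ _ _ j k.
move=> /(congr1 (fun x : R => x%:C * u z)).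
rewrite !(rmorphD, rmorphN, rmorphM, rmorph_nat, rmorph1)/= => e.
move/eqP: e; rewrite -subr_eq0 => /eqP e; rewrite -[RHS]e /kappa; ring.
Qed.

Lemma defect_harmonic_sum v : harmonic_sum v -> defect v = fun=> 0.
Proof.
elim=> [j k {}v|a {}u {}v hu u0 hv v0]; first exact: defect_harmonic.
rewrite defect_comb ?u0 ?v0; [|exact: harmonic_sum_smooth..].
by apply/funext => z; rewrite mulr0 addr0.
Qed.

(** All the moments of [defect u] against powers of the peak function at z vanish,
    since these powers are sums of harmonics, [defect] is symmetric, and it
    kills sums of harmonics. *)
Lemma defect_eq0 u z : sphere_smooth u -> defect u z = 0.
Proof.
move=> su; have [F [G [sF sG uE]]] := defect_smooth su.
have moments m : cintegral sigma (fun y => defect u y * (peak z y ^+ m)%:C) = 0.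
  have hp := harmonic_sum_peak z m.
  have := defect_selfadjoint su (harmonic_sum_smooth hp).
  rewrite (defect_harmonic_sum hp) inner0r// => <-; congr cintegral.
  by apply/funext => y; congr (_ * _); apply/eqP; rewrite eq_complex/= oppr0 !eqxx.
have cF := smooth_continuous sF; have cG := smooth_continuous sG.
have F0 : F (sphere_pt z) = 0.
  apply: (peak_separation sigma_inv cF) => m.
  have /(congr1 (@complex.Re R)) /= <- := moments m.
  by apply: eq_Rintegral => y _; rewrite uE /= mulr0 subr0.
have G0 : G (sphere_pt z) = 0.
  apply: (peak_separation sigma_inv cG) => m.
  have /(congr1 (@complex.Im R)) /= <- := moments m.
  by apply: eq_Rintegral => y _; rewrite uE /= mulr0 add0r.
by rewrite uE -/(sphere_pt z) F0 G0.
Qed.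

End Operator.

Theorem theorem1p3 (R : realType) (n : nat)
    (sigma : probability (borel_sphere (R := R) n) R)
    (gamma w w' : R)
    (A B : (sphere (R := R) n -> R[i]) -> (sphere (R := R) n -> R[i])) :
  unitary_invariant sigma ->
  0 < gamma < n.+1%:R ->
  w + w' + n%:R + 1 = gamma ->
  w - w' \is a Num.int ->
  normalized_intertwining sigma gamma w w' A ->
  normalized_intertwining sigma (gamma - 1) (w - 1) w' B ->
  forall (u : sphere (R := R) n -> R[i]), sphere_smooth u ->
  forall z : sphere (R := R) n,
    \sum_(l < n.+1) (sphere_coord l z)^* * coord_commutator A l u z
    = (gamma * (gamma - 1 - w'))%:C * B u z.
Proof.
move=> sigma_inv /andP[gamma_gt0 _] wE wZ hA hB u su z.
apply/eqP; rewrite -subr_eq0 -defectE; apply/eqP.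
exact: (defect_eq0 sigma_inv gamma_gt0 wE wZ hA hB).
Qed.
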